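(* Let $\Gamma=(V,E,s,t)$ be a multiquiver, $\gamma:\mathbb{Z}V\to\mathbb{Z}E$ its incidence matrix, $A=\mathcal{A}(\Gamma)$ the associated TGW algebra and $C_A(R_E)=\{a\in A\mid ar=ra\ \forall r\in R_E\}$ the centralizer of $R_E$ in $A$. Then $$C_A(R_E)=\bigoplus_{d\in\ker\gamma}A_d.$$ In particular, $\gamma$ is injective if and only if $R_E$ is maximal commutative in $A$.
   Context: $\Bbbk$ is a field of characteristic zero; rings are associative and unital; $\mathbb{Z}X$ denotes the free abelian group on a set $X$. TGW algebras. A TGW datum $(R,\sigma,t)$ with index set $I$: a $\Bbbk$-algebra $R$, commuting $\Bbbk$-algebra automorphisms $\sigma=(\sigma_i)_{i\in I}$ of $R$, nonzero central elements $t=(t_i)_{i\in I}$ of $R$. Given $\mu=(\mu_{ij})_{i\ne j}$ with $\mu_{ij}\in\Bbbk\setminus\{0\}$, $\mathcal{C}_\mu(R,\sigma,t)$ is the free $R$-ring on symbols $X_i,Y_i$ ($i\in I$) modulo the relations $X_ir=\sigma_i(r)X_i$, $Y_ir=\sigma_i^{-1}(r)Y_i$, $Y_iX_i=t_i$, $X_iY_i=\sigma_i(t_i)$ ($r\in R$, $i\in I$), $X_iY_j=\mu_{ij}Y_jX_i$ ($i\neq j$). It is $\mathbb{Z}I$-graded by $\deg X_i=i$, $\deg Y_i=-i$, $\deg r=0$. The TGW algebra $\mathcal{A}_\mu(R,\sigma,t)$ is the quotient of $\mathcal{C}_\mu(R,\sigma,t)$ by the sum of all graded ideals having zero intersection with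 the degree-zero component; it is $\mathbb{Z}I$-graded. Multiquivers. A multiquiver $\Gamma=(V,E,s,t)$ consists of sets $V$, $E$ and functions $s,t:E\to (V\times\mathbb{Z}_{>0})\cup\{\emptyset\}$ such that (no loops) if $s(e)=(u,m)$ and $t(e)=(v,n)$ then $u\ne v$; and (local finiteness) for each $v\in V$ only finitely many $e$ have $s(e)\in\{v\}\times\mathbb{Z}_{>0}$ or $t(e)\in\{v\}\times\mathbb{Z}_{>0}$. The incidence matrix is $\gamma:\mathbb{Z}V\to\mathbb{Z}E$, $\gamma(v)=\sum_{e\in E}\gamma_{ev}e$, where $\gamma_{ev}=n$ if $t(e)=(v,n)$, $\gamma_{ev}=-n$ if $s(e)=(v,n)$, and $\gamma_{ev}=0$ otherwise. $\mathcal{A}(\Gamma)$ is the TGW algebra $\mathcal{A}_\mu(R_E,\sigma^\Gamma,t^\Gamma)$ with index set $V$, where all $\mu_{ij}=1$, $R_E=\Bbbk[u_e\mid e\in E]$ (polynomial algebra), $\sigma_v(u_e)=u_e-\gamma_{ev}$, $t_v=\prod_{e\in E}u_{ev}$ with $u_{ev}=u_e(u_e+1)\cdots(u_e+\gamma_{ev}-1)$ if $\gamma_{ev}>0$, $u_{ev}=1$ if $\gamma_{ev}=0$, $u_{ev}=(u_e-1)(u_e-2)\cdots(u_e-|\gamma_{ev}|)$ if $\gamma_{ev}<0$. The canonical map $R_E\to\mathcal{A}(\Gamma)$ is injective, and $R_E$ is identified with its image. $A_d$ ($d\in\mathbb{Z}V$) denotes the degree $d$ component of $A=\mathcal{A}(\Gamma)$.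 *)

(* Defs.v *)
From HB Require Import structures.
From mathcomp Require Import all_boot all_order all_algebra finmap.
From mathcomp Require Import boolp classical_sets cardinality fsbigop.
From mathcomp Require Import generic_quotient monalg.

Set Implicit Arguments.
Unset Strict Implicit.
Unset Printing Implicit Defensive.

Import GRing.Theory.
Local Open Scope classical_set_scope.
Local Open Scope ring_scope.
Local Open Scope quotient_scope.

Section Ideals.
Variable S : pzRingType.
Implicit Types (J G : set S).

Record is_ideal J : Prop := IsIdeal {
  ideal0 : J 0;
  idealB : forall x y, J x -> J y -> J (x - y);
  idealMl : forall a x, J x -> J (a * x);
  idealMr : forall a x, J x -> J (x * a) }.

Definition ideal_gen G : set S :=
  [set x | forall J, is_ideal J -> G `<=` J -> J x].

Lemma ideal_gen_ideal G : is_ideal (ideal_gen G).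
Proof.
split=> [J idJ _|x y Ix Iy J idJ GJ|a x Ix J idJ GJ|a x Ix J idJ GJ].
- exact: ideal0.
- by apply: idealB => //; [apply: Ix|apply: Iy].
- by apply: idealMl => //; apply: Ix.
- by apply: idealMr => //; apply: Ix.
Qed.

Lemma ideal_gen_sub G : G `<=` ideal_gen G.
Proof. by move=> x Gx J _; apply. Qed.

(* The sum of a family of ideals: the smallest ideal containing them all. *)
Definition ideal_sum (F : set (set S)) : set S :=
  ideal_gen (\bigcup_(J in F) J).

Lemma idealN J x : is_ideal J -> J x -> J (- x).
Proof. by move=> idJ Jx; rewrite -sub0r; apply: idealB => //; apply: ideal0. Qed.

Lemma idealD J x y : is_ideal J -> J x -> J y -> J (x + y).
Proof.
by move=> idJ Jx Jy; rewrite -[y]opprK; apply: idealB => //; apply: idealN.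
Qed.

End Ideals.

Section RingQuotient.
Variables (S : pzRingType) (G : set S).

Definition rquot_eq (x y : S) : bool := `[< ideal_gen G (x - y) >].

Let idG := ideal_gen_ideal G.

Fact rquot_eq_equiv : equiv_class_of rquot_eq.
Proof.
split=> [x|x y|y x z].
- by apply/asboolP; rewrite subrr; apply: ideal0.
- by apply/asboolP/asboolP => /(idealN idG); rewrite opprB.
- move=> /asboolP xy /asboolP yz; apply/asboolP.
  by have := idealD idG xy yz; rewrite addrA subrK.
Qed.

Canonical rquot_equiv := EquivRelPack rquot_eq_equiv.

(** [rquot G] is the quotient of [S] by the two-sided ideal generated by [G]. *)
Definition rquot := {eq_quot rquot_eq}.

HB.instance Definition _ := Choice.on rquot.

Definition rquot_pi (x : S) : rquot := \pi_rquot x.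

Lemma rquot_piP x y : rquot_pi x = rquot_pi y <-> ideal_gen G (x - y).
Proof.
split=> [/eqmodP/asboolP //|xy]; exact/eqmodP/asboolP.
Qed.

Lemma rquot_surj (q : rquot) : exists x, q = rquot_pi x.
Proof. by exists (repr q); rewrite /rquot_pi reprK. Qed.

Let rep (q : rquot) : S := repr q.

Let repK q : rquot_pi (rep q) = q. Proof. exact: reprK. Qed.

Let repP x : ideal_gen G (rep (rquot_pi x) - x).
Proof. by apply/rquot_piP; rewrite repK. Qed.

Definition rquot_add (p q : rquot) := rquot_pi (rep p + rep q).
Definition rquot_opp (p : rquot) := rquot_pi (- rep p).
Definition rquot_mul (p q : rquot) := rquot_pi (rep p * rep q).

Let piD x y : rquot_add (rquot_pi x) (rquot_pi y) = rquot_pi (x + y).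
Proof.
apply/rquot_piP; have := idealD idG (repP x) (repP y).
by rewrite addrACA -opprD.
Qed.

Let piN x : rquot_opp (rquot_pi x) = rquot_pi (- x).
Proof.
by apply/rquot_piP; rewrite -opprD; apply: idealN idG _; apply: repP.
Qed.

Let piM x y : rquot_mul (rquot_pi x) (rquot_pi y) = rquot_pi (x * y).
Proof.
apply/rquot_piP.
have h1 := idealMr idG (rep (rquot_pi y)) (repP x).
have h2 := idealMl idG x (repP y).
by have := idealD idG h1 h2; rewrite mulrBl mulrBr addrA subrK.
Qed.

Fact rquot_addA : associative rquot_add.
Proof.
move=> p q r; case: (rquot_surj p) (rquot_surj q) (rquot_surj r).
by move=> x -> [y ->] [z ->]; rewrite !piD addrA.
Qed.

Fact rquot_addC : commutative rquot_add.
Proof. by move=> p q; rewrite /rquot_add addrC. Qed.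

Fact rquot_add0 : left_id (rquot_pi 0) rquot_add.
Proof. by move=> p; case: (rquot_surj p) => x ->; rewrite piD add0r. Qed.

Fact rquot_addN : left_inverse (rquot_pi 0) rquot_opp rquot_add.
Proof. by move=> p; case: (rquot_surj p) => x ->; rewrite piN piD addNr. Qed.

HB.instance Definition _ :=
  GRing.isZmodule.Build rquot rquot_addA rquot_addC rquot_add0 rquot_addN.

Fact rquot_mulA : associative rquot_mul.
Proof.
move=> p q r; case: (rquot_surj p) (rquot_surj q) (rquot_surj r).
by move=> x -> [y ->] [z ->]; rewrite !piM mulrA.
Qed.

Fact rquot_mul1 : left_id (rquot_pi 1) rquot_mul.
Proof. by move=> p; case: (rquot_surj p) => x ->; rewrite piM mul1r. Qed.

Fact rquot_mulr1 : right_id (rquot_pi 1) rquot_mul.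
Proof. by move=> p; case: (rquot_surj p) => x ->; rewrite piM mulr1. Qed.

Fact rquot_mulDl : left_distributive rquot_mul rquot_add.
Proof.
move=> p q r; case: (rquot_surj p) (rquot_surj q) (rquot_surj r).
by move=> x -> [y ->] [z ->]; rewrite !(piD, piM) mulrDl.
Qed.

Fact rquot_mulDr : right_distributive rquot_mul rquot_add.
Proof.
move=> p q r; case: (rquot_surj p) (rquot_surj q) (rquot_surj r).
by move=> x -> [y ->] [z ->]; rewrite !(piD, piM) mulrDr.
Qed.

HB.instance Definition _ := GRing.Zmodule_isPzRing.Build rquot
  rquot_mulA rquot_mul1 rquot_mulr1 rquot_mulDl rquot_mulDr.

Fact rquot_pi_is_zmod_morphism : zmod_morphism rquot_pi.
Proof. by move=> x y; rewrite -piD -piN. Qed.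

Fact rquot_pi_is_monoid_morphism : monoid_morphism rquot_pi.
Proof. by split=> // x y; rewrite -piM. Qed.

HB.instance Definition _ :=
  GRing.isZmodMorphism.Build S rquot rquot_pi rquot_pi_is_zmod_morphism.
HB.instance Definition _ :=
  GRing.isMonoidMorphism.Build S rquot rquot_pi rquot_pi_is_monoid_morphism.

End RingQuotient.

(** The free [R]-ring on [W] is the free ring on the symbols [inl r] (for [r : R]) and [inr w]
    (for [w : W]) modulo the relations making [r |-> inl r] a ring morphism. *)
Section FreeRing.
Variables (R : pzRingType) (W : choiceType).

Local Notation F := {malg int[{fmonom (R + W)%type}]}.

Let cst (r : R) : F := << fmu (inl r) >>.

Inductive frel : set F :=
| frelD r s : frel (cst (r + s) - (cst r + cst s))
| frelM r s : frel (cst (r * s) - cst r * cst s)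
| frel1 : frel (cst 1 - 1).

Definition frring : pzRingType := rquot frel.
Definition frring_cst (r : R) : frring := rquot_pi frel (cst r).
Definition frring_sym (w : W) : frring := rquot_pi frel << fmu (inr w) >>.

End FreeRing.

(** A TGW datum [(R, sigma, t)] with its parameters [mu]; the diagonal values
    [mu i i] are not used. [tgw_sigV i] is the inverse of [tgw_sig i]. *)
Record tgw_datum (k : fieldType) (I : choiceType) := TGWDatum {
  tgw_R :> algType k;
  tgw_sig : I -> {lrmorphism tgw_R -> tgw_R};
  tgw_sigV : I -> tgw_R -> tgw_R;
  tgw_t : I -> tgw_R;
  tgw_mu : I -> I -> k;
  tgw_sigK : forall i, cancel (tgw_sig i) (tgw_sigV i);
  tgw_sigVK : forall i, cancel (tgw_sigV i) (tgw_sig i);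
  tgw_sigC : forall i j r, tgw_sig i (tgw_sig j r) = tgw_sig j (tgw_sig i r);
  tgw_tC : forall i r, tgw_t i * r = r * tgw_t i;
  tgw_t_neq0 : forall i, tgw_t i != 0;
  tgw_mu_neq0 : forall i j, i != j -> tgw_mu i j != 0 }.

Arguments tgw_sig {k I} D i : rename.
Arguments tgw_sigV {k I} D i r : rename.
Arguments tgw_t {k I} D i : rename.
Arguments tgw_mu {k I} D i j : rename.

Section TGW.
Variables (k : fieldType) (I : choiceType) (D : tgw_datum k I).

Local Notation R := (tgw_R D).
Local Notation F := (frring R (I + I)%type).
Local Notation cst := (@frring_cst R (I + I)%type).
Local Notation X i := (@frring_sym R (I + I)%type (inl i)).
Local Notation Y i := (@frring_sym R (I + I)%type (inr i)).
Local Notation sig := (tgw_sig D).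
Local Notation sigV := (tgw_sigV D).
Local Notation t := (tgw_t D).
Local Notation mu := (tgw_mu D).

Inductive tgw_rel : set F :=
| tgw_relX i r : tgw_rel (X i * cst r - cst (sig i r) * X i)
| tgw_relY i r : tgw_rel (Y i * cst r - cst (sigV i r) * Y i)
| tgw_relYX i : tgw_rel (Y i * X i - cst (t i))
| tgw_relXY i : tgw_rel (X i * Y i - cst (sig i (t i)))
| tgw_relXYC i j : i != j ->
    tgw_rel (X i * Y j - cst (mu i j)%:A * Y j * X i).

(** The algebra [C_mu(R, sigma, t)]. *)
Definition tgwC : pzRingType := rquot tgw_rel.
Definition tgwC_cst (r : R) : tgwC := rquot_pi tgw_rel (cst r).
Definition tgwC_X (i : I) : tgwC := rquot_pi tgw_rel (X i).
Definition tgwC_Y (i : I) : tgwC := rquot_pi tgw_rel (Y i).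

(** Its homogeneous components; [{malg int[I]}] is the free abelian group on
    [I], with basis [<< i >>]. *)
Inductive tgwC_deg : {malg int[I]} -> set tgwC :=
| tgwC_deg_cst r : tgwC_deg 0 (tgwC_cst r)
| tgwC_degX i : tgwC_deg << i >> (tgwC_X i)
| tgwC_degY i : tgwC_deg (- << i >>) (tgwC_Y i)
| tgwC_degM d e a b :
    tgwC_deg d a -> tgwC_deg e b -> tgwC_deg (d + e) (a * b)
| tgwC_deg0 d : tgwC_deg d 0
| tgwC_degB d a b : tgwC_deg d a -> tgwC_deg d b -> tgwC_deg d (a - b).

(** [J] is graded when it is the sum of its homogeneous parts. *)
Definition graded_ideal (J : set tgwC) : Prop :=
  is_ideal J /\
  forall a, J a -> exists s : seq tgwC,
    (forall x, x \in s -> J x /\ exists d, tgwC_deg d x) /\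
    a = \sum_(x <- s) x.

Definition tgw_rad : set tgwC :=
  ideal_sum [set J | graded_ideal J /\ J `&` tgwC_deg 0 = [set 0]].

Definition tgwA : pzRingType := rquot tgw_rad.
Definition tgwA_cst (r : R) : tgwA := rquot_pi tgw_rad (tgwC_cst r).
Definition tgwA_deg (d : {malg int[I]}) : set tgwA :=
  rquot_pi tgw_rad @` tgwC_deg d.

End TGW.

Section Polynomials.
Variables (k : fieldType) (E : choiceType).

(** The polynomial algebra [k[u_e | e in E]]. *)
Definition polE : comAlgType k := {malg k[{cmonom E}]}.

Definition polX (e : E) : polE := << ucm e >>.

Section Eval.
Variables (S : comNzRingType) (f : {rmorphism k -> S}) (h : E -> S).

Definition pol_mon (m : {cmonom E}) : S := \prod_(e <- finsupp m) h e ^+ m e.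

Lemma pol_monEw (d : {fset E}) (m : {cmonom E}) : (finsupp m `<=` d)%fset ->
  pol_mon m = \prod_(e <- d) h e ^+ m e.
Proof.
move=> le; rewrite /pol_mon (big_fset_incl _ le) // => i _.
by rewrite -cmE_neq0 negbK => /eqP ->.
Qed.

Fact pol_mon_mmorphism : mmorphism pol_mon.
Proof.
split=> [m n|]; last by rewrite /pol_mon mdom1 big_seq_fset0.
rewrite (pol_monEw (d := finsupp m `|` finsupp n)%fset) ?mdomD //.
rewrite (pol_monEw (fsubsetUl (finsupp m) (finsupp n))).
rewrite (pol_monEw (fsubsetUr (finsupp m) (finsupp n))).
by rewrite -big_split; apply: eq_bigr => e _; rewrite cmM exprD.
Qed.

HB.instance Definition _ :=
  isMultiplicative.Build {cmonom E} S pol_mon pol_mon_mmorphism.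

(** The ring morphism from [polE] to [S] extending [f] and mapping
    the variable [u_e] to [h e]. *)
Definition pol_eval : polE -> S := mmap f pol_mon.

HB.instance Definition _ := GRing.RMorphism.copy pol_eval (mmap f pol_mon).

Lemma pol_evalX e : pol_eval (polX e) = h e.
Proof.
rewrite /pol_eval /polX mmapU /= /pol_mon mdomU big_seq_fset1 cmUU expr1.
by rewrite (rmorph1 f) mul1r.
Qed.

Lemma pol_evalC (c : k) : pol_eval c%:A = f c.
Proof. by rewrite /pol_eval mmapZ -/pol_eval rmorph1 mulr1. Qed.

End Eval.

Section Subst.
Variable h : E -> polE.

Definition pol_subst : polE -> polE := pol_eval (GRing.in_alg polE) h.

HB.instance Definition _ := GRing.RMorphism.on pol_subst.

Fact pol_subst_scalable : scalable pol_subst.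
Proof.
by move=> c p; rewrite -mulr_algl rmorphM /= {1}/pol_subst pol_evalC mulr_algl.
Qed.

HB.instance Definition _ :=
  GRing.isScalable.Build k polE polE *:%R pol_subst pol_subst_scalable.

Lemma pol_substX e : pol_subst (polX e) = h e.
Proof. exact: pol_evalX. Qed.

End Subst.

Lemma polU_prod (m : {cmonom E}) : << m >> = pol_mon polX m :> polE.
Proof.
have [n] := ubnP (mdeg m); elim: n m => // n IHn m.
rewrite ltnS => le_mn; have [->|] := eqVneq m mone.
  by rewrite (pol_mon_mmorphism polX).2.
rewrite -mdeg_eq0 /mdeg; case: (fset_0Vmem (finsupp m)) => [->|[e em]].
  by rewrite big_seq_fset0.
have me : (0 < m e)%N by rewrite lt0n cmE_neq0.
pose m' : {cmonom E} := divcm m (ucm e).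
have def_m : m = mmul (ucm e) m'.
  apply/eqP/cmP => i; rewrite cmM cmU divcmE cmU.
  by case: eqVneq => [<-|_] /=; [rewrite subnKC|rewrite subn0 add0n].
have {}IHn : << m' >> = pol_mon polX m' :> polE.
  by apply: IHn; rewrite -add1n -(mdegU e) -mdegM -def_m.
move=> _; rewrite def_m (pol_mon_mmorphism polX).1 -IHn.
rewrite /pol_mon mdomU big_seq_fset1 cmUU expr1 /polX.
by rewrite malgM_def fgmulUU mulr1.
Qed.

Lemma pol_ext (f g : {lrmorphism polE -> polE}) :
  (forall e, f (polX e) = g (polX e)) -> f =1 g.
Proof.
move=> fg p; rewrite [p]monalgE (raddf_sum f) (raddf_sum g); apply: eq_bigr => m _ /=.
have -> : << p@_m *g m >> = p@_m *: (<< m >> : polE).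
  by rewrite -mul_malgC malgM_def fgmulUU mul1m mulr1.
rewrite (linearZ_LR f) (linearZ_LR g) polU_prod /pol_mon; congr (_ *: _).
rewrite (rmorph_prod f) (rmorph_prod g).
by apply: eq_bigr => e _; rewrite (rmorphXn f) (rmorphXn g) /= fg.
Qed.

End Polynomials.

(** The value [None] stands for the symbol "empty set". *)
Record multiquiver (V E : choiceType) := Multiquiver {
  mq_src : E -> option (V * nat);
  mq_tgt : E -> option (V * nat);
  mq_src_gt0 : forall e v n, mq_src e = Some (v, n) -> (0 < n)%N;
  mq_tgt_gt0 : forall e v n, mq_tgt e = Some (v, n) -> (0 < n)%N;
  mq_noloop : forall e u m v n,
    mq_src e = Some (u, m) -> mq_tgt e = Some (v, n) -> u != v;
  mq_locfin : forall v, finite_set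
    [set e | (exists n, mq_src e = Some (v, n)) \/
             (exists n, mq_tgt e = Some (v, n))] }.

Section MultiquiverTGW.
Variables (k : fieldType) (V E : choiceType) (Q : multiquiver V E).

Definition mq_at (o : option (V * nat)) (v : V) : option nat :=
  if o is Some (w, n) then if w == v then Some n else None else None.

Definition mq_coef (e : E) (v : V) : int :=
  match mq_at (mq_tgt Q e) v, mq_at (mq_src Q e) v with
  | Some n, _ => n%:Z
  | None, Some n => - n%:Z
  | None, None => 0
  end.

Lemma mq_atP o v n : mq_at o v = Some n <-> o = Some (v, n).
Proof.
case: o => [[w m]|] //=; case: eqVneq => [->|wv].
  by split=> -[->].
by split=> // -[wv']; rewrite wv' eqxx in wv.
Qed.

Lemma mq_coef_finite v : finite_set [set e | mq_coef e v != 0].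
Proof.
apply: sub_finite_set (mq_locfin Q v) => e /=; rewrite /mq_coef.
case: (mq_at (mq_tgt Q e) v) (@mq_atP (mq_tgt Q e) v) => [n /(_ n)[h _] _|_].
  by right; exists n; apply: h.
case: (mq_at (mq_src Q e) v) (@mq_atP (mq_src Q e) v) => [n /(_ n)[h _] _|//].
by left; exists n; apply: h.
Qed.

(** The incidence matrix, as a map from [ZV] to [ZE]. *)
Definition mq_gamma (d : {malg int[V]}) : {malg int[E]} :=
  \sum_(v <- msupp d)
    (\sum_(e \in [set: E]) << mq_coef e v *g e >>) *~ d@_v.

Local Notation polE := (polE k E).
Local Notation u := (@polX k E).

Definition mq_sig (v : V) : polE -> polE :=
  pol_subst (fun e => u e - (mq_coef e v)%:~R).

Definition mq_sigV (v : V) : polE -> polE :=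
  pol_subst (fun e => u e + (mq_coef e v)%:~R).

HB.instance Definition _ v := GRing.LRMorphism.on (mq_sig v).
HB.instance Definition _ v := GRing.LRMorphism.on (mq_sigV v).

(* At [mq_coef e v = 0] this is the empty product; [Negz n] is [- n.+1]. *)
Definition mq_u (e : E) (v : V) : polE :=
  match mq_coef e v with
  | Posz n => \prod_(j < n) (u e + j%:R)
  | Negz n => \prod_(j < n.+1) (u e - j.+1%:R)
  end.

Definition mq_t (v : V) : polE :=
  \big[*%R/1]_(e \in [set: E]) mq_u e v.

Lemma mq_sigX v e : mq_sig v (u e) = u e - (mq_coef e v)%:~R.
Proof. exact: pol_substX. Qed.

Lemma mq_sigVX v e : mq_sigV v (u e) = u e + (mq_coef e v)%:~R.
Proof. exact: pol_substX. Qed.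

Lemma mq_sig_shift v e z :
  mq_sig v (u e + z%:~R) = u e - (mq_coef e v)%:~R + z%:~R.
Proof. by rewrite (rmorphD (mq_sig v)) (rmorph_int (mq_sig v)) /= mq_sigX. Qed.

Fact mq_sigK v : cancel (mq_sig v) (mq_sigV v).
Proof.
move=> p; apply: (@pol_ext k E (mq_sigV v \o mq_sig v) idfun) => e /=.
rewrite mq_sigX (rmorphB (mq_sigV v)) (rmorph_int (mq_sigV v)) /=.
by rewrite mq_sigVX addrK.
Qed.

Fact mq_sigVK v : cancel (mq_sigV v) (mq_sig v).
Proof.
move=> p; apply: (@pol_ext k E (mq_sig v \o mq_sigV v) idfun) => e /=.
by rewrite mq_sigVX mq_sig_shift subrK.
Qed.

Fact mq_sigC v w p : mq_sig v (mq_sig w p) = mq_sig w (mq_sig v p).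
Proof.
apply: (@pol_ext k E (mq_sig v \o mq_sig w) (mq_sig w \o mq_sig v)) => e /=.
by rewrite !mq_sigX -!mulrNz !mq_sig_shift !mulrNz addrAC.
Qed.

Fact mq_t_neq0 v : mq_t v != 0.
Proof.
have [f f_u] : exists f : {rmorphism polE -> {poly k}}, forall e, f (u e) = 'X.
  by exists (pol_eval (@polyC k) (fun=> 'X)) => e; apply: pol_evalX.
have : f (mq_t v) \is monic.
  rewrite /mq_t (rmorph_prod f); apply: monic_prod => e _; rewrite /mq_u.
  case: (mq_coef e v) => n /=; rewrite (rmorph_prod f); apply: monic_prod => j _.
    by rewrite (rmorphD f) (rmorph_nat f) f_u -polyC_natr monicXaddC.
  by rewrite (rmorphB f) (rmorph_nat f) f_u -polyC_natr monicXsubC.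
by apply: contraL => /eqP ->; rewrite (rmorph0 f) monicE lead_coef0 eq_sym oner_eq0.
Qed.

Definition mq_datum : tgw_datum k V := @TGWDatum k V polE mq_sig mq_sigV mq_t
  (fun _ _ => 1) mq_sigK mq_sigVK mq_sigC (fun _ _ => mulrC _ _) mq_t_neq0
  (fun _ _ _ => oner_neq0 _).

Definition mq_alg : pzRingType := tgwA mq_datum.
(** The image of the polynomial algebra [k[u_e | e in E]] in [mq_alg]. *)
Definition mq_R : set mq_alg := range (@tgwA_cst k V mq_datum).
Definition mq_deg : {malg int[V]} -> set mq_alg := @tgwA_deg k V mq_datum.

End MultiquiverTGW.

Arguments mq_alg k {V E} Q.
Arguments mq_R k {V E} Q _.
Arguments mq_deg k {V E} Q _ _.

Section Centralizers.
Variable S : pzRingType.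
Implicit Types B : set S.

Definition centralizer B : set S := [set a | forall r, B r -> a * r = r * a].

Definition is_subring B : Prop :=
  [/\ B 1, (forall x y, B x -> B y -> B (x - y)) &
      (forall x y, B x -> B y -> B (x * y))].

Definition commutative_set B : Prop := forall x y, B x -> B y -> x * y = y * x.

Definition maximal_commutative B : Prop :=
  [/\ is_subring B, commutative_set B &
      forall B', is_subring B' -> commutative_set B' -> B `<=` B' -> B' = B].

End Centralizers.

(** [B] is the internal direct sum of the [M d] for [d] in [P]. *)
Definition is_direct_sum (S : zmodType) (D : choiceType) (B : set S)
    (P : set D) (M : D -> set S) : Prop :=
  B = [set x | exists (s : {fset D}) (f : D -> S),
         (forall d, d \in s -> P d /\ M d (f d)) /\ x = \sum_(d <- s) f d] /\
  (forall (s : {fset D}) (f : D -> S),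
     (forall d, d \in s -> P d /\ M d (f d)) ->
     \sum_(d <- s) f d = 0 -> forall d, d \in s -> f d = 0).

(* Main.v *)
(** Let [M] be the module of functions from [ZV] to [R_E]. The Weyl algebra on [E] suggests an
    action of [C] on [M] by weighted shifts: [p] in [R_E] multiplies the value at [d] by the
    translate [p (u + gamma d)], while [X_v] and [Y_v] shift by [v] and [-v] with
    weights that are products of factors [u_e + z], hence regular. Homogeneous elements of
    degree [d] act by weighted shifts by [d], and [C_0 = R_E] acts faithfully; since
    every degree contains an element acting injectively, the kernel of the action
    is exactly the radical defining [A]. So [A] is a ring of operators, in which
    the grading is visibly direct, and the commutator with [u_e] multiplies the weight of a
    degree [d] component by the [e]-th coordinate of [gamma d]. *)

Require Import Defs.
From HB Require Import structures.
From mathcomp Require Import all_boot all_order all_algebra finmap.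
From mathcomp Require Import boolp classical_sets functions cardinality fsbigop.
From mathcomp Require Import generic_quotient monalg.

Set Implicit Arguments.
Unset Strict Implicit.
Unset Printing Implicit Defensive.

Import GRing.Theory.
Local Open Scope classical_set_scope.
Local Open Scope ring_scope.

(** * Weighted shift operators and lifting of morphisms *)

Section Operators.
Variables (D : zmodType) (S : nzRingType).

(** Additivity is what makes composition distribute over sums on the right. All functions are
    allowed, so constants serve as test vectors besides the functions [delta c]. *)
Record operator := Operator {
  operator_fun :> (D -> S) -> D -> S;
  operator_additive : zmod_morphism operator_fun }.

HB.instance Definition _ := gen_eqMixin operator.
HB.instance Definition _ := gen_choiceMixin operator.

Lemma operatorP (a b : operator) : (forall g d, a g d = b g d) -> a = b.
Proof.
case: a b => [a a_add] [b b_add] /= ab.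
have {}ab : a = b by apply/funext => g; apply/funext => d.
by subst b; congr Operator; apply: Prop_irrelevance.
Qed.

Lemma operatorB (a : operator) f g d : a (f - g) d = a f d - a g d.
Proof. by rewrite operator_additive. Qed.

Lemma operator0 (a : operator) d : a 0 d = 0.
Proof. by rewrite -(subrr 0) operatorB subrr. Qed.

Lemma operatorN (a : operator) g d : a (- g) d = - a g d.
Proof. by rewrite -sub0r operatorB operator0 sub0r. Qed.

Lemma operatorD (a : operator) f g d : a (f + g) d = a f d + a g d.
Proof. by rewrite -{1}[g]opprK operatorB operatorN opprK. Qed.

Fact operator_zero_subproof : zmod_morphism (fun (_ : D -> S) (_ : D) => 0 : S).
Proof. by move=> f g; apply/funext => d; rewrite !fctE subrr. Qed.
Definition operator_zero := Operator operator_zero_subproof.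

Fact operator_opp_subproof (a : operator) : zmod_morphism (fun g d => - a g d).
Proof. by move=> f g; apply/funext => d; rewrite !fctE operatorB opprD. Qed.
Definition operator_opp a := Operator (operator_opp_subproof a).

Fact operator_add_subproof (a b : operator) :
  zmod_morphism (fun g d => a g d + b g d).
Proof.
by move=> f g; apply/funext => d; rewrite !fctE !operatorB opprD addrACA.
Qed.
Definition operator_add a b := Operator (operator_add_subproof a b).

Fact operator_one_subproof : zmod_morphism (fun g : D -> S => g).
Proof. by []. Qed.
Definition operator_one := Operator operator_one_subproof.

Fact operator_mul_subproof (a b : operator) : zmod_morphism (fun g => a (b g)).
Proof. by move=> f g; rewrite !operator_additive. Qed.
Definition operator_mul a b := Operator (operator_mul_subproof a b).

Fact operator_addA : associative operator_add.
Proof. by move=> a b c; apply: operatorP => g d /=; rewrite addrA. Qed.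
Fact operator_addC : commutative operator_add.
Proof. by move=> a b; apply: operatorP => g d /=; rewrite addrC. Qed.
Fact operator_add0 : left_id operator_zero operator_add.
Proof. by move=> a; apply: operatorP => g d /=; rewrite add0r. Qed.
Fact operator_addN : left_inverse operator_zero operator_opp operator_add.
Proof. by move=> a; apply: operatorP => g d /=; rewrite addNr. Qed.

HB.instance Definition _ := GRing.isZmodule.Build operator
  operator_addA operator_addC operator_add0 operator_addN.

Fact operator_mulA : associative operator_mul.
Proof. by move=> a b c; apply: operatorP. Qed.
Fact operator_mul1 : left_id operator_one operator_mul.
Proof. by move=> a; apply: operatorP. Qed.
Fact operator_mulr1 : right_id operator_one operator_mul.
Proof. by move=> a; apply: operatorP. Qed.
Fact operator_mulDl : left_distributive operator_mul operator_add.
Proof. by move=> a b c; apply: operatorP. Qed.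
Fact operator_mulDr : right_distributive operator_mul operator_add.
Proof.
by move=> a b c; apply: operatorP => g d /=; rewrite -operatorD.
Qed.
Fact operator_one_neq0 : operator_one != 0.
Proof.
apply/eqP => /(congr1 (fun a : operator => a (fun=> 1) 0)) /= /eqP.
by rewrite oner_eq0.
Qed.

HB.instance Definition _ := GRing.Zmodule_isNzRing.Build operator
  operator_mulA operator_mul1 operator_mulr1 operator_mulDl operator_mulDr
  operator_one_neq0.

Lemma operator_sumE (I : Type) (r : seq I) (P : pred I) (F : I -> operator) g d :
  (\sum_(i <- r | P i) F i) g d = \sum_(i <- r | P i) F i g d.
Proof. by elim/big_rec2: _ => //= i y1 y2 _ <-. Qed.

Fact shift_op_subproof (w : D -> S) (s : D) :
  zmod_morphism (fun (g : D -> S) d => w d * g (d - s)).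
Proof. by move=> f g; apply/funext => d; rewrite !fctE mulrBr. Qed.
Definition shift_op w s := Operator (shift_op_subproof w s).

Lemma shift_opE w s g d : shift_op w s g d = w d * g (d - s).
Proof. by []. Qed.

Definition delta (c d : D) : S := (d == c)%:R.

Lemma shift_op_delta w s d : shift_op w s (delta (d - s)) d = w d.
Proof. by rewrite shift_opE /delta eqxx mulr1. Qed.

(* Applied to [delta (d - s)], only the summand of shift [s] survives at [d]. *)
Lemma sum_shift_op_eq0 (r : {fset D}) (w : D -> D -> S) :
  \sum_(s <- r) shift_op (w s) s = 0 ->
  forall s, s \in r -> forall d, w s d = 0.
Proof.
move=> sum0 s sr d.
have := congr1 (fun a : operator => a (delta (d - s)) d) sum0.
rewrite operator_sumE (big_fsetD1 s) //= big1_fset ?addr0 => [|c].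
  by rewrite /delta eqxx mulr1.
rewrite in_fsetD1 => /andP[cs _] _; rewrite /delta.
by rewrite (inj_eq (addrI d)) eqr_opp (negPf cs) mulr0.
Qed.

(** Evaluated at [d] on [delta (d - s)], the left side gives [w d] and the right side gives zero.
    This will show that a nonzero element of nonzero degree does not lie in the image of [R_E]. *)
Lemma shift_op_disjoint w s w' s' :
  s != s' -> shift_op w s = shift_op w' s' -> forall d, w d = 0.
Proof.
move=> ss' ww' d; rewrite -(shift_op_delta w s) ww' shift_opE /delta.
by rewrite (inj_eq (addrI d)) eqr_opp eq_sym (negPf ss') mulr0.
Qed.

Lemma shift_opM w s w' s' :
  shift_op w s * shift_op w' s' =
  shift_op (fun d => w d * w' (d - s)) (s + s').
Proof. by apply: operatorP => g d /=; rewrite mulrA opprD addrA. Qed.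

Lemma shift_opB w w' s :
  shift_op w s - shift_op w' s = shift_op (fun d => w d - w' d) s.
Proof. by apply: operatorP => g d /=; rewrite mulrBl. Qed.

Lemma shift_op_inj w s :
  (forall d, GRing.lreg (w d)) -> injective (shift_op w s).
Proof.
move=> w_reg f g fg; apply/funext => d.
have := congr1 (fun h => h (d + s)) fg; rewrite /= addrK.
exact: w_reg.
Qed.

End Operators.

(** * Commutators of weighted shifts with diagonal operators *)

Section DiagonalOperators.
Variables (D : zmodType) (S : comNzRingType).
Implicit Types (w p : D -> S).

(** The shift is unchanged and the weight picks up a finite difference of [p]. When [p] comes from a
    variable [u_e], this difference is an integer, the [e]-th coordinate of [gamma s]. *)
Lemma shift_op_commutator w p s : shift_op p 0 * shift_op w s -
  shift_op w s * shift_op p 0 = shift_op (fun d => (p d - p (d - s)) * w d) s.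
Proof.
apply: operatorP => g d /=; rewrite !subr0 mulrBl mulrBl !mulrA.
by rewrite [w d * _]mulrC.
Qed.

Lemma shift_op_comm w p s : (forall d, p (d - s) = p d) ->
  shift_op w s * shift_op p 0 = shift_op p 0 * shift_op w s.
Proof.
move=> ps; apply/esym/eqP; rewrite -subr_eq0 shift_op_commutator; apply/eqP.
by apply: operatorP => g d /=; rewrite ps subrr !mul0r.
Qed.

(** The commutator is again a sum of weighted shifts by the same distinct amounts, so each of its
    weights vanishes separately. *)
Lemma sum_shift_op_comm (r : {fset D}) (w : D -> D -> S) p :
  (\sum_(s <- r) shift_op (w s) s) * shift_op p 0 =
  shift_op p 0 * (\sum_(s <- r) shift_op (w s) s) ->
  forall s, s \in r -> forall d, (p d - p (d - s)) * w s d = 0.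
Proof.
move=> comm; apply: (@sum_shift_op_eq0 _ _ r (fun s d => (p d - p (d - s)) * w s d)).
move/esym/eqP: comm; rewrite -subr_eq0 mulr_sumr mulr_suml -sumrB.
move/eqP; apply: etrans; apply: eq_bigr => s _.
by rewrite shift_op_commutator.
Qed.

End DiagonalOperators.

(** * Universal properties of ring quotients, free [R]-rings and [C_mu] *)

Section Lifting.

Lemma rquot_lift (S T : pzRingType) (G : set S) (phi : {rmorphism S -> T}) :
  (forall x, G x -> phi x = 0) ->
  exists psi : {rmorphism rquot G -> T}, forall x, psi (rquot_pi G x) = phi x.
Proof.
move=> phiG.
have phi0 x : ideal_gen G x -> phi x = 0.
  (* The kernel of [phi] is one of the ideals containing [G]. *)
  move=> /(_ [set y | phi y = 0]); apply => //.
  by split=> [|y z /= y0 z0|a y /= y0|a y /= y0];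
    rewrite /= ?rmorph0 ?rmorphB ?rmorphM ?y0 ?z0 ?subr0 ?mulr0 ?mul0r.
(* The value at [q] is specified against every representative at once, so the morphism laws can be
   checked on arbitrary representatives. *)
have /choice[f fP] (q : rquot G) : exists y, forall x, q = rquot_pi G x -> y = phi x.
  have [x0 ->] := rquot_surj q; exists (phi x0) => x /rquot_piP /phi0 /eqP.
  by rewrite rmorphB subr_eq0 => /eqP.
have fB : zmod_morphism f.
  move=> p q; have [x ->] := rquot_surj p; have [y ->] := rquot_surj q.
  rewrite (fP (rquot_pi G x) x) // (fP (rquot_pi G y) y) // -(rmorphB phi).
  by apply: fP; rewrite rmorphB.
have fM : monoid_morphism f.
  split=> [|p q]; first by rewrite (fP _ 1) ?rmorph1.
  have [x ->] := rquot_surj p; have [y ->] := rquot_surj q.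
  rewrite (fP (rquot_pi G x) x) // (fP (rquot_pi G y) y) // -(rmorphM phi).
  by apply: fP; rewrite rmorphM.
pose psi := HB.pack_for {rmorphism rquot G -> T} f
  (GRing.isZmodMorphism.Build _ _ f fB) (GRing.isMonoidMorphism.Build _ _ f fM).
by exists psi => x; apply: fP.
Qed.

Section FreeRingLift.
Variables (R : pzRingType) (W : choiceType) (T : nzRingType).
Variables (f : {rmorphism R -> T}) (h : W -> T).

Let letter (l : R + W) : T := match l with inl r => f r | inr w => h w end.
Let word (m : {fmonom (R + W)%type}) : T := \prod_(l <- (m : seq _)) letter l.

Fact word_mmorphism : mmorphism word.
Proof. by split=> [m n|]; rewrite /word ?fmM ?big_cat ?fm1 ?big_nil. Qed.

HB.instance Definition _ := isMultiplicative.Build _ _ word word_mmorphism.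

Lemma frring_lift : exists psi : {rmorphism frring R W -> T},
  (forall r, psi (frring_cst W r) = f r) /\
  (forall w, psi (frring_sym R w) = h w).
Proof.
pose phi0 : {malg int[{fmonom (R + W)%type}]} -> T := mmap (intmul 1) word.
(* [T] may be noncommutative, but the coefficients are integers and these are central in it. *)
have phi0M : monoid_morphism phi0.
  have [] := @commr_mmap_is_multiplicative _ _ _ (intmul 1) word; last by [].
  by move=> g m m'; apply: commr_sym; apply: commr_int.
pose phi := HB.pack_for {rmorphism {malg int[{fmonom (R + W)%type}]} -> T} phi0
  (GRing.isZmodMorphism.Build _ _ phi0 (@mmap_is_additive _ _ _ _ _))
  (GRing.isMonoidMorphism.Build _ _ phi0 phi0M).
have phiU l : phi << fmu l >> = letter l.
  by rewrite /phi /= /phi0 mmapU mul1r /= /word fmU big_seq1.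
have [|psi psiE] := @rquot_lift _ _ (@Defs.frel R W) phi.
  move=> x [r s|r s|]; rewrite (rmorphB phi).
  - by rewrite (rmorphD phi) !phiU /letter (rmorphD f) subrr.
  - by rewrite (rmorphM phi) !phiU /letter (rmorphM f) subrr.
  - by rewrite (rmorph1 phi) !phiU /letter (rmorph1 f) subrr.
exists psi; split=> [r|w]; first by rewrite /frring_cst psiE phiU.
by rewrite /frring_sym psiE phiU.
Qed.

End FreeRingLift.

Lemma tgwC_lift (k : fieldType) (I : choiceType) (D : tgw_datum k I)
    (T : nzRingType) (f : {rmorphism D -> T}) (x y : I -> T) :
    (forall i r, x i * f r = f (tgw_sig D i r) * x i) ->
    (forall i r, y i * f r = f (tgw_sigV D i r) * y i) ->
    (forall i, y i * x i = f (tgw_t D i)) ->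
    (forall i, x i * y i = f (tgw_sig D i (tgw_t D i))) ->
    (forall i j, i != j -> x i * y j = f (tgw_mu D i j)%:A * y j * x i) ->
  exists psi : {rmorphism tgwC D -> T},
    [/\ forall r, psi (tgwC_cst r) = f r, forall i, psi (tgwC_X D i) = x i
      & forall i, psi (tgwC_Y D i) = y i].
Proof.
move=> xr yr yx xy xyC.
pose h (w : I + I) := match w with inl i => x i | inr i => y i end.
have [phi [phi_cst phi_sym]] := frring_lift f h.
have [|psi psiE] := @rquot_lift _ _ (@tgw_rel k I D) phi.
  have phiB u v : phi u = phi v -> phi (u - v) = 0.
    by move=> uv; rewrite (rmorphB phi) uv subrr.
  have phiM u v u' v' : u' = phi u -> v' = phi v -> phi (u * v) = u' * v'.
    by move=> -> ->; exact: (rmorphM phi).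
  have phiX i : x i = phi (frring_sym _ (inl i)) by rewrite phi_sym.
  have phiY i : y i = phi (frring_sym _ (inr i)) by rewrite phi_sym.
  have phic r : f r = phi (frring_cst _ r) by rewrite phi_cst.
  move=> z [i r|i r|i|i|i j ij]; apply: phiB.
  - apply: (etrans (phiM _ _ _ _ (phiX i) (phic r))); rewrite xr.
    exact: (esym (phiM _ _ _ _ (phic _) (phiX i))).
  - apply: (etrans (phiM _ _ _ _ (phiY i) (phic r))); rewrite yr.
    exact: (esym (phiM _ _ _ _ (phic _) (phiY i))).
  - by apply: (etrans (phiM _ _ _ _ (phiY i) (phiX i))); rewrite yx phic.
  - by apply: (etrans (phiM _ _ _ _ (phiX i) (phiY i))); rewrite xy phic.
  - apply: (etrans (phiM _ _ _ _ (phiX i) (phiY j))); rewrite xyC //.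
    apply: esym; apply: (phiM _ _ _ _ _ (phiX i)).
    exact: (esym (phiM _ _ _ _ (phic _) (phiY j))).
exists psi; split=> z.
- by rewrite /tgwC_cst psiE phi_cst.
- by rewrite /tgwC_X psiE phi_sym.
- by rewrite /tgwC_Y psiE phi_sym.
Qed.

End Lifting.

(** * Structure of [C_mu(R, sigma, t)] *)

(** Used to turn the relation for [X_i Y_j] into one for [Y_j X_i] by inverting [mu_ij]. *)
Lemma quasi_commute_sym (S : pzRingType) (c c' x y : S) :
  c' * c = 1 -> x * y = c * y * x -> y * x = c' * x * y.
Proof. by move=> cc' xy; rewrite -mulrA xy !mulrA cc' mul1r. Qed.

(** Choosing the first occurrence lets [X_i] move past all the preceding letters [Y_j], each with
    [j] different from [i]. *)
Lemma first_occurrence (T : eqType) (x : T) (s : seq T) : x \in s ->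
  exists s1 s2, s = s1 ++ x :: s2 /\ x \notin s1.
Proof.
elim: s => // y s IHs; have [<-|xy] := eqVneq x y; first by exists [::], s.
rewrite inE (negPf xy) => /IHs[s1 [s2 [-> xs1]]].
by exists (y :: s1), s2; rewrite inE negb_or xy xs1.
Qed.

(** * Normal monomials: a coefficient, then letters [X], then letters [Y] *)

Section NormalForm.
Variables (R S : pzRingType) (I : choiceType).
Variables (cst : {rmorphism R -> S}) (X Y : I -> S).
(** The relations are recorded up to unspecified coefficients from [R]: only the shape of the words
    matters for finding the component of degree zero. *)
Hypothesis XR : forall i r, exists r', X i * cst r = cst r' * X i.
Hypothesis YR : forall i r, exists r', Y i * cst r = cst r' * Y i.
Hypothesis YX : forall i, exists r, Y i * X i = cst r.
Hypothesis XY : forall i, exists r, X i * Y i = cst r.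
Hypothesis XYC : forall i j, i != j -> exists r, X i * Y j = cst r * Y j * X i.
Hypothesis YXC : forall i j, i != j -> exists r, Y j * X i = cst r * X i * Y j.

Local Notation ZI := {malg int[I]}.
Local Notation Xs a := (\prod_(i <- a) X i).
Local Notation Ys b := (\prod_(i <- b) Y i).
Let wt (a : seq I) : ZI := \sum_(i <- a) << i >>.

Lemma prod_cst (Z : I -> S) (a : seq I) r :
  (forall i r, exists r', Z i * cst r = cst r' * Z i) ->
  exists r', (\prod_(i <- a) Z i) * cst r = cst r' * \prod_(i <- a) Z i.
Proof.
move=> ZR; elim: a => [|i a [r1 e1]]; first by exists r; rewrite big_nil mulr1 mul1r.
have [r2 e2] := ZR i r1; exists r2.
by rewrite big_cons -mulrA e1 !mulrA e2.
Qed.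

(** [Y_i] moves right through the word. Either it meets an [X_i], and the pair collapses to a
    coefficient, or it reaches the end and becomes the single letter of [b']. The degree is
    preserved in both cases. *)
Lemma Y_Xs i a : exists r a' b',
  Y i * Xs a = cst r * Xs a' * Ys b' /\ wt a' - wt b' = wt a - << i >>.
Proof.
elim: a => [|j a [r [a' [b' [e we]]]]].
  exists 1, [::], [:: i]; rewrite !big_nil big_seq1 rmorph1 !mulr1 mul1r.
  by rewrite /wt !big_nil big_seq1.
have [->|ji] := eqVneq j i.
  have [r1 e1] := YX i; exists r1, a, [::].
  rewrite big_cons mulrA e1 big_nil mulr1; split=> //.
  by rewrite /wt big_cons big_nil subr0 addrAC subrr add0r.
have [r1 e1] := YXC ji; have [r2 e2] := XR j r; exists (r1 * r2), (j :: a'), b'.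
rewrite !big_cons mulrA e1 -!mulrA e !mulrA -(mulrA _ (X j)) e2 rmorphM !mulrA.
by split=> //; rewrite /wt !big_cons -addrA we addrA.
Qed.

Lemma X_Ys i b : i \notin b -> exists r, X i * Ys b = cst r * Ys b * X i.
Proof.
elim: b => [|j b IHb]; first by exists 1; rewrite big_nil rmorph1 !mul1r mulr1.
rewrite inE negb_or => /andP[ij /IHb [r e]].
have [r1 e1] := XYC ij; have [r2 e2] := YR j r; exists (r1 * r2).
by rewrite big_cons mulrA e1 -mulrA e !mulrA -(mulrA _ (Y j)) e2 rmorphM !mulrA.
Qed.

(** Induction on [a] from its right end: the last [X_i] moves to the first [Y_i], the pair collapses
    to a coefficient, and this coefficient is carried to the far left. *)
Lemma Xs_Ys_perm a b : perm_eq a b -> exists r, Xs a * Ys b = cst r.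
Proof.
elim/last_ind: a b => [|a i IHa] b.
  rewrite perm_sym => /perm_nilP ->.
  by exists 1; rewrite !big_nil mulr1 rmorph1.
move=> ab; have : i \in b by rewrite -(perm_mem ab) mem_rcons mem_head.
case/first_occurrence => b1 [b2 [def_b ib1]].
have {IHa}/IHa[r e] : perm_eq a (b1 ++ b2).
  rewrite -(perm_cons i) -perm_rcons; apply: perm_trans ab _.
  by rewrite def_b perm_catC /= perm_cons perm_catC.
have [r1 e1] := X_Ys ib1; have [r2 e2] := XY i.
(* [r1] arises from moving [X_i] past [b1], and [r2] is [X_i Y_i]. Carrying [r2] left past [b1]
   gives [r3], and carrying [r1 * r3] left past [a] gives [r4]. *)
have [r3 e3] := prod_cst b1 r2 YR; have [r4 e4] := prod_cst a (r1 * r3) XR.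
exists (r4 * r).
rewrite def_b -cats1 big_cat /= big_seq1 [\prod_(j <- _ ++ i :: _) _]big_cat /=.
rewrite big_cons -mulrA (mulrA (X i)) e1 -!mulrA (mulrA (X i)) e2.
rewrite (mulrA (Ys b1)) e3 !mulrA -(mulrA (Xs a)) -rmorphM e4 rmorphM -e.
by rewrite big_cat /= !mulrA.
Qed.

(** The words [a] and [b] may share letters. Normal monomials are used as a spanning set, and no
    independence is claimed. *)
Inductive normal_sum : ZI -> S -> Prop :=
| normal_sum_mon r a b :
    normal_sum (wt a - wt b) (cst r * Xs a * Ys b)
| normal_sum0 d : normal_sum d 0
| normal_sumB d x y : normal_sum d x -> normal_sum d y -> normal_sum d (x - y).

Lemma normal_sum_mul d z :
  (forall r a b, normal_sum (d + (wt a - wt b)) (z * (cst r * Xs a * Ys b))) ->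
  forall e x, normal_sum e x -> normal_sum (d + e) (z * x).
Proof.
move=> nz e x; elim=> // {e x} [e|e x y _ IHx _ IHy].
  by rewrite mulr0; apply: normal_sum0.
by rewrite mulrBr; apply: normal_sumB.
Qed.

Lemma normal_sum1 : normal_sum 0 1.
Proof.
have := normal_sum_mon 1 [::] [::].
by rewrite !big_nil /wt !big_nil subrr rmorph1 !mulr1.
Qed.

Lemma normal_sum_cst r e x : normal_sum e x -> normal_sum (0 + e) (cst r * x).
Proof.
apply: normal_sum_mul => r' a b.
by rewrite add0r !mulrA -rmorphM; apply: normal_sum_mon.
Qed.

Lemma normal_sum_X i e x : normal_sum e x -> normal_sum (<< i >> + e) (X i * x).
Proof.
apply: normal_sum_mul => r a b; have [r' e'] := XR i r.
have := normal_sum_mon r' (i :: a) b.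
by rewrite big_cons !mulrA -e' /wt big_cons addrA.
Qed.

Lemma normal_sum_Y i e x : normal_sum e x -> normal_sum (- << i >> + e) (Y i * x).
Proof.
apply: normal_sum_mul => r a b; have [r' e'] := YR i r.
have [r1 [a' [b' [e1 we]]]] := Y_Xs i a.
have := normal_sum_mon (r' * r1) a' (b' ++ b).
rewrite big_cat /= !mulrA e' -(mulrA _ (Y i)) e1 rmorphM !mulrA.
rewrite [wt (b' ++ b)]big_cat /= opprD addrA we.
by rewrite [- _ + _]addrC (addrAC (wt a)).
Qed.

Lemma mcoeff_wt a i : (wt a)@_i = (count_mem i a)%:Z.
Proof.
rewrite /wt; elim: a => [|j a IHa]; first by rewrite big_nil mcoeff0.
by rewrite big_cons mcoeffD mcoeffU IHa /= PoszD; case: (j == i).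
Qed.

(** The group [ZI] is free, so two words of equal weight have equal letter counts and are
    permutations of each other. [Xs_Ys_perm] then collapses each monomial. *)
Lemma normal_sum_deg0 x : normal_sum 0 x -> exists r, x = cst r.
Proof.
suff nsx d : normal_sum d x -> d = 0 -> exists r, x = cst r by move/nsx; apply.
elim=> {d x}.
- move=> r a b /eqP; rewrite subr_eq0 => /eqP ab.
  have /Xs_Ys_perm[r' e] : perm_eq a b.
    rewrite /perm_eq; apply/allP => i _ /=; apply/eqP.
    by have := congr1 (mcoeff i) ab; rewrite !mcoeff_wt => -[].
  by exists (r * r'); rewrite -mulrA e rmorphM.
- by move=> e _; exists 0; rewrite rmorph0.
- move=> e y z _ IHy _ IHz /[dup] /IHy[r ->] /IHz[r' ->].
  by exists (r - r'); rewrite rmorphB.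
Qed.

End NormalForm.

(** * Relations, generation and the degree-zero component of [C_mu] *)

Section TGWStructure.
Variables (k : fieldType) (I : choiceType) (D : tgw_datum k I).

Local Notation C := (tgwC D).
Local Notation cst := (@tgwC_cst k I D).
Local Notation X := (tgwC_X D).
Local Notation Y := (tgwC_Y D).
Local Notation ZI := {malg int[I]}.

Lemma tgwC_rel_eq u v :
  tgw_rel (u - v) -> rquot_pi (@tgw_rel k I D) u = rquot_pi (@tgw_rel k I D) v.
Proof. by move=> uv; apply/rquot_piP; apply: ideal_gen_sub. Qed.

Lemma tgwC_piM u v : rquot_pi (@tgw_rel k I D) (u * v) =
  rquot_pi (@tgw_rel k I D) u * rquot_pi (@tgw_rel k I D) v.
Proof. exact: (rmorphM (rquot_pi (@tgw_rel k I D))). Qed.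

Lemma tgwC_XR i r : X i * cst r = cst (tgw_sig D i r) * X i.
Proof.
apply: (etrans (esym (tgwC_piM _ _))); apply: (etrans _ (tgwC_piM _ _)).
exact: (tgwC_rel_eq (tgw_relX _ _)).
Qed.

Lemma tgwC_YR i r : Y i * cst r = cst (tgw_sigV D i r) * Y i.
Proof.
apply: (etrans (esym (tgwC_piM _ _))); apply: (etrans _ (tgwC_piM _ _)).
exact: (tgwC_rel_eq (tgw_relY _ _)).
Qed.

Lemma tgwC_YX i : Y i * X i = cst (tgw_t D i).
Proof.
apply: (etrans (esym (tgwC_piM _ _))).
exact: (tgwC_rel_eq (tgw_relYX _ _)).
Qed.

Lemma tgwC_XY i : X i * Y i = cst (tgw_sig D i (tgw_t D i)).
Proof.
apply: (etrans (esym (tgwC_piM _ _))).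
exact: (tgwC_rel_eq (tgw_relXY _ _)).
Qed.

Lemma tgwC_XYC i j : i != j -> X i * Y j = cst (tgw_mu D i j)%:A * Y j * X i.
Proof.
move=> ij; apply: (etrans (esym (tgwC_piM _ _))).
apply: (etrans (tgwC_rel_eq (tgw_relXYC D ij))).
exact: (etrans (tgwC_piM _ _) (congr1 ( *%R^~ (X i)) (tgwC_piM _ _))).
Qed.

Lemma frring_cst_zmod_morphism (R : pzRingType) (W : choiceType) :
  zmod_morphism (@frring_cst R W).
Proof.
have cstD (r s : R) : frring_cst W (r + s) = frring_cst W r + frring_cst W s.
  rewrite /frring_cst -rmorphD; apply/rquot_piP.
  by apply: ideal_gen_sub; apply: (@frelD R W).
by move=> r s; apply/eqP; rewrite eq_sym subr_eq -cstD subrK.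
Qed.

Lemma frring_cst_monoid_morphism (R : pzRingType) (W : choiceType) :
  monoid_morphism (@frring_cst R W).
Proof.
split=> [|r s]; rewrite /frring_cst -?rmorph1 -?rmorphM; apply/rquot_piP.
  by apply: ideal_gen_sub; apply: (@frel1 R W).
by apply: ideal_gen_sub; apply: (@frelM R W).
Qed.

Fact tgwC_cst_zmod_morphism : zmod_morphism cst.
Proof.
move=> r s; rewrite /tgwC_cst frring_cst_zmod_morphism.
exact: (rmorphB (rquot_pi (@tgw_rel k I D))).
Qed.

Fact tgwC_cst_monoid_morphism : monoid_morphism cst.
Proof.
split=> [|r s]; rewrite /tgwC_cst.
  rewrite (frring_cst_monoid_morphism _ _).1.
  exact: (rmorph1 (rquot_pi (@tgw_rel k I D))).
by rewrite (frring_cst_monoid_morphism _ _).2; apply: tgwC_piM.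
Qed.

HB.instance Definition _ :=
  GRing.isZmodMorphism.Build D C cst tgwC_cst_zmod_morphism.
HB.instance Definition _ :=
  GRing.isMonoidMorphism.Build D C cst tgwC_cst_monoid_morphism.

(** [C] is a quotient of a quotient of an integral monoid ring. The predicate is pulled back to that
    ring and checked on letters, then words, then integer combinations of words. *)
Lemma tgwC_ind (P : C -> Prop) :
    (forall r, P (cst r)) -> (forall i, P (X i)) -> (forall i, P (Y i)) ->
    (forall a b, P a -> P b -> P (a - b)) ->
    (forall a b, P a -> P b -> P (a * b)) ->
  forall a, P a.
Proof.
move=> Pc PX PY PB PM.
have P0 : P 0 by have := Pc 0; rewrite (rmorph0 cst).
have P1 : P 1 by have := Pc 1; rewrite (rmorph1 cst).
have PN a : P a -> P (- a) by rewrite -sub0r; apply: PB.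
have PD a b : P a -> P b -> P (a + b).
  by move=> Pa Pb; rewrite -[b]opprK; apply: PB => //; apply: PN.
move=> a; have [b ->] := rquot_surj a; have [x ->] := rquot_surj b.
pose W : choiceType := (I + I)%type.
pose F := {malg int[{fmonom (D + W)%type}]}.
pose Q (y : F) := P (rquot_pi (@tgw_rel k I D) (rquot_pi (@Defs.frel D W) y)).
have piE (T : pzRingType) (G : set T) :
  [/\ rquot_pi G 0 = 0, rquot_pi G 1 = 1, {morph rquot_pi G : u v / u - v},
    {morph rquot_pi G : u v / u + v} & {morph rquot_pi G : u v / u * v}].
  by split; [apply: rmorph0|apply: rmorph1|apply: rmorphB|apply: rmorphD
            |apply: rmorphM].
have [p0 p1 pB pD pM] := piE _ (@Defs.frel D W).
have [q0 q1 qB qD qM] := piE _ (@tgw_rel k I D).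
have Q0 : Q 0 by rewrite /Q p0 q0.
have Q1 : Q 1 by rewrite /Q p1 q1.
have QB u v : Q u -> Q v -> Q (u - v) by rewrite /Q pB qB; apply: PB.
have QD u v : Q u -> Q v -> Q (u + v) by rewrite /Q pD qD; apply: PD.
have QM u v : Q u -> Q v -> Q (u * v) by rewrite /Q pM qM; apply: PM.
have Ql l : Q << fmu l >>.
  by case: l => [r|[i|i]]; [exact: Pc|exact: PX|exact: PY].
have Qm m : Q << m >>.
  case: m => s; elim: s => [|l s IHs]; first by rewrite -[FMonom _]fmoneE.
  have -> : FMonom (l :: s) = mmul (fmu l) (FMonom s).
    by apply/eqP; rewrite -val_eqE /= fmM fmU.
  have -> : << mmul (fmu l) (FMonom s) >> = << fmu l >> * << FMonom s >> :> F.
    by rewrite malgM_def fgmulUU mulr1.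
  exact: (QM _ _ (Ql l) IHs).
suff: Q x by [].
rewrite [x]monalgE; elim/big_ind: _ => [||m _]; [exact: Q0|exact: QD|].
have QMn n : Q (<< m >> *+ n).
  by elim: n => [|n IHn]; [exact: Q0|rewrite mulrS; exact: (QD _ _ (Qm m) IHn)].
have -> : << x@_m *g m >> = << m >> *~ x@_m :> F.
  by rewrite -{1}[x@_m]intz; apply: (raddfMz (mkmalgU m)).
case: (x@_m) => n; first exact: QMn.
by rewrite NegzE mulrNz -sub0r; apply: QB => //; apply: QMn.
Qed.

Lemma tgwC_YXC i j : i != j ->
  Y j * X i = cst ((tgw_mu D i j)^-1)%:A * X i * Y j.
Proof.
move=> ij; apply: quasi_commute_sym (tgwC_XYC ij).
have muV : ((tgw_mu D i j)^-1)%:A * (tgw_mu D i j)%:A = 1 :> D.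
  by rewrite -scalerAl mul1r scalerA mulVf ?tgw_mu_neq0 // scale1r.
by apply: (etrans (esym (rmorphM cst _ _))); rewrite muV; apply: (rmorph1 cst).
Qed.

(** Degrees may repeat in the list, so differences and products are obtained by concatenating and
    pairing lists. Terms are grouped by degree in [tgwC_decomposition]. *)
Inductive homogeneous_sum : C -> Prop := HomogeneousSum (s : seq (ZI * C)) of
  (forall p, p \in s -> tgwC_deg p.1 p.2) : homogeneous_sum (\sum_(p <- s) p.2).

Lemma homogeneous_sumP a : homogeneous_sum a.
Proof.
have hom d b : tgwC_deg d b -> homogeneous_sum b.
  move=> db; have <- : \sum_(p <- [:: (d, b)]) p.2 = b by rewrite big_seq1.
  by apply: HomogeneousSum => p; rewrite inE => /eqP ->.
apply: (tgwC_ind (P := homogeneous_sum)) a => [r|i|i|_ _ [s hs] [s' hs']|].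
- exact: (hom _ _ (tgwC_deg_cst r)).
- exact: (hom _ _ (tgwC_degX D i)).
- exact: (hom _ _ (tgwC_degY D i)).
- pose s'' := s ++ [seq (p.1, - p.2) | p <- s'].
  have -> : \sum_(p <- s) p.2 - \sum_(p <- s') p.2 = \sum_(p <- s'') p.2.
    by rewrite big_cat big_map /= sumrN.
  apply: HomogeneousSum => p; rewrite mem_cat => /orP[/hs //|/mapP[q /hs' hq ->]].
  by rewrite /= -sub0r; apply: tgwC_degB hq; apply: tgwC_deg0.
- move=> _ _ [s hs] [s' hs'].
  pose s'' := [seq (p.1 + q.1, p.2 * q.2) | p <- s, q <- s'].
  have -> : (\sum_(p <- s) p.2) * (\sum_(p <- s') p.2) = \sum_(p <- s'') p.2.
    rewrite big_allpairs_dep /= mulr_suml; apply: eq_bigr => p _.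
    by rewrite mulr_sumr.
  apply: HomogeneousSum => _ /allpairsP[[p q] [/= /hs hp /hs' hq ->]].
  exact: tgwC_degM.
Qed.

Lemma tgwC_deg0E a : tgwC_deg 0 a -> exists r, a = cst r.
Proof.
have XR i r : exists r', X i * cst r = cst r' * X i.
  by exists (tgw_sig D i r); apply: tgwC_XR.
have YR i r : exists r', Y i * cst r = cst r' * Y i.
  by exists (tgw_sigV D i r); apply: tgwC_YR.
have YX i : exists r, Y i * X i = cst r by exists (tgw_t D i); apply: tgwC_YX.
have XY i : exists r, X i * Y i = cst r.
  by exists (tgw_sig D i (tgw_t D i)); apply: tgwC_XY.
have XYC i j : i != j -> exists r, X i * Y j = cst r * Y j * X i.
  by move=> ij; exists (tgw_mu D i j)%:A; apply: tgwC_XYC.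
have YXC i j : i != j -> exists r, Y j * X i = cst r * X i * Y j.
  by move=> ij; exists ((tgw_mu D i j)^-1)%:A; apply: tgwC_YXC.
(* Stated as left multiplication on normal sums, the claim goes through products by associativity.
   It is then applied to the normal sum [1]. *)
suff deg_normal d b : tgwC_deg d b -> forall e x,
    normal_sum cst X Y e x -> normal_sum cst X Y (d + e) (b * x).
  move=> /deg_normal /(_ _ _ (normal_sum1 cst X Y)).
  rewrite (addr0 0) (mulr1 a); exact: (normal_sum_deg0 XR YR XY XYC).
elim=> {d b} [r|i|i|d e x y _ IHx _ IHy|d|d x y _ IHx _ IHy] f z nz.
- exact: (normal_sum_cst r nz).
- exact: (normal_sum_X XR i nz).
- exact: (normal_sum_Y XR YR YX YXC i nz).
- by rewrite -addrA -(mulrA x y z); exact: (IHx _ _ (IHy _ _ nz)).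
- by rewrite (mul0r z); exact: normal_sum0.
- by rewrite (mulrBl z x y); exact: (normal_sumB (IHx _ _ nz) (IHy _ _ nz)).
Qed.

Fact tgwA_cst_zmod_morphism : zmod_morphism (@tgwA_cst k I D).
Proof.
move=> r s; rewrite /tgwA_cst (rmorphB cst).
exact: (rmorphB (rquot_pi (@tgw_rad k I D))).
Qed.

Fact tgwA_cst_monoid_morphism : monoid_morphism (@tgwA_cst k I D).
Proof.
split=> [|r s]; rewrite /tgwA_cst.
  by rewrite (rmorph1 cst); exact: (rmorph1 (rquot_pi (@tgw_rad k I D))).
by rewrite (rmorphM cst); exact: (rmorphM (rquot_pi (@tgw_rad k I D))).
Qed.

HB.instance Definition _ :=
  GRing.isZmodMorphism.Build D (tgwA D) (@tgwA_cst k I D) tgwA_cst_zmod_morphism.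
HB.instance Definition _ :=
  GRing.isMonoidMorphism.Build D (tgwA D) (@tgwA_cst k I D)
    tgwA_cst_monoid_morphism.

End TGWStructure.

(** * Decomposition into homogeneous components *)

Section HomogeneousDecomposition.
Variables (k : fieldType) (I : choiceType) (D : tgw_datum k I).
Local Notation ZI := {malg int[I]}.

Lemma tgwC_degD d (a b : tgwC D) :
  tgwC_deg d a -> tgwC_deg d b -> tgwC_deg d (a + b).
Proof.
move=> da db; rewrite -(opprK b); apply: tgwC_degB => //.
by rewrite -sub0r; apply: tgwC_degB => //; apply: tgwC_deg0.
Qed.

Lemma tgwC_decomposition (a : tgwC D) : exists (s : {fset ZI}) (f : ZI -> tgwC D),
  (forall d, tgwC_deg d (f d)) /\ a = \sum_(d <- s) f d.
Proof.
case: (homogeneous_sumP a) => {a} s hs.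
(* All terms of degree [d] are collected. For a degree that does not occur, the sum is empty, and
   zero has every degree. *)
pose f d := \sum_(p <- s | p.1 == d) p.2.
exists [fset p.1 | p in s]%fset, f; split=> [d|].
  rewrite /f big_seq_cond; elim/big_ind: _ => [||p /andP[/hs dp /eqP <-]] //.
    exact: tgwC_deg0.
  by move=> x y; apply: tgwC_degD.
rewrite /f (exchange_big_dep predT) //= big_seq [RHS]big_seq; apply: eq_bigr => p ps.
have p1s : p.1 \in [fset p.1 | p in s]%fset by apply/imfsetP; exists p.
rewrite -big_filter.
have -> : [seq d <- [fset p.1 | p in s]%fset | p.1 == d] = [:: p.1].
  rewrite -(filter_pred1_uniq (fset_uniq _) p1s).
  by apply: eq_filter => d /=; rewrite eq_sym.
by rewrite big_seq1.
Qed.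

Lemma tgwA_deg0E a : @tgwA_deg k I D 0 a -> exists r, a = tgwA_cst r.
Proof. by case=> c /tgwC_deg0E[r ->] <-; exists r. Qed.

Lemma tgwA_decomposition (a : tgwA D) : exists (s : {fset ZI}) (f : ZI -> tgwA D),
  (forall d, tgwA_deg d (f d)) /\ a = \sum_(d <- s) f d.
Proof.
have [c ->] := rquot_surj a; have [s [f [fd ->]]] := tgwC_decomposition c.
exists s, (fun d => rquot_pi (@tgw_rad k I D) (f d)); split=> [d|].
  by exists (f d).
exact: (raddf_sum (rquot_pi (@tgw_rad k I D))).
Qed.

End HomogeneousDecomposition.

(** * The kernel of a shift representation is the radical *)

Section ShiftRepresentation.
Variables (k : fieldType) (I : choiceType) (D : tgw_datum k I).
Local Notation ZI := {malg int[I]}.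
Variables (S : nzRingType) (rho : {rmorphism tgwC D -> operator ZI S}).

Hypothesis rho_cst : forall r, exists w, rho (tgwC_cst r) = shift_op w 0.
Hypothesis rho_X : forall i, exists2 w, forall d, GRing.lreg (w d) &
  rho (tgwC_X D i) = shift_op w << i >>.
Hypothesis rho_Y : forall i, exists2 w, forall d, GRing.lreg (w d) &
  rho (tgwC_Y D i) = shift_op w (- << i >>).
Hypothesis rho_inj : forall r, rho (tgwC_cst r) = 0 -> r = 0.

Lemma rho_deg d a : tgwC_deg d a -> exists w, rho a = shift_op w d.
Proof.
elim=> {d a} [r|i|i|d e a b _ [w ew] _ [w' ew']|d|d a b _ [w ew] _ [w' ew']].
- exact: rho_cst.
- by have [w _ e] := rho_X i; exists w.
- by have [w _ e] := rho_Y i; exists w.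
- by rewrite (rmorphM rho) ew ew' shift_opM; eexists.
- by exists (fun=> 0); rewrite (rmorph0 rho); apply: operatorP => g c /=; rewrite mul0r.
- by rewrite (rmorphB rho) ew ew' shift_opB; eexists.
Qed.

(** The generators act with regular weights, hence injectively, and injectivity is stable under
    products. Powers of [X_i] and [Y_i] realise positive and negative multiples of [<< i >>]. *)
Lemma ex_injective_deg d : exists2 c, tgwC_deg d c & injective (rho c).
Proof.
pose P d := exists2 c, tgwC_deg d c & injective (rho c).
have P0 : P 0.
  exists (tgwC_cst 1); first exact: tgwC_deg_cst.
  by rewrite (rmorph1 (@tgwC_cst k I D)) (rmorph1 rho) => f g.
have PD a b : P a -> P b -> P (a + b).
  case=> c dc ci [c' dc' c'i]; exists (c * c'); first exact: tgwC_degM.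
  by rewrite (rmorphM rho) => f g /ci /c'i.
have PX i : P << i >>.
  have [w w_reg e] := rho_X i; exists (tgwC_X D i); first exact: tgwC_degX.
  by rewrite e; apply: shift_op_inj.
have PY i : P (- << i >>).
  have [w w_reg e] := rho_Y i; exists (tgwC_Y D i); first exact: tgwC_degY.
  by rewrite e; apply: shift_op_inj.
have PXn i n : P (<< i >> *+ n).
  by elim: n => [|n IHn]; [exact: P0|rewrite mulrS; apply: PD].
have PYn i n : P (- << i >> *+ n).
  by elim: n => [|n IHn]; [exact: P0|rewrite mulrS; apply: PD].
rewrite -/(P d) [d]monalgE; elim/big_ind: _ => [||i _]; [exact: P0|exact: PD|].
have -> : << d@_i *g i >> = << i >> *~ d@_i :> ZI.
  by rewrite -{1}[d@_i]intz; apply: (raddfMz (mkmalgU i)).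
by case: (d@_i) => n; [apply: PXn|rewrite NegzE mulrNz -mulNrn; apply: PYn].
Qed.

Lemma rho_ker_ideal : is_ideal [set a | rho a = 0].
Proof.
split=> [|x y /= x0 y0|a x /= x0|a x /= x0] /=.
- exact: (rmorph0 rho).
- by rewrite (rmorphB rho) x0 y0 subr0.
- by rewrite (rmorphM rho) x0 mulr0.
- by rewrite (rmorphM rho) x0 mul0r.
Qed.

(** This independence of shifts is what makes the kernel of [rho] a graded ideal. *)
Lemma rho_sum_eq0 (s : {fset ZI}) (f : ZI -> tgwC D) :
  (forall d, d \in s -> tgwC_deg d (f d)) -> rho (\sum_(d <- s) f d) = 0 ->
  forall d, d \in s -> rho (f d) = 0.
Proof.
move=> fd f0.
have /choice[w ew] d : exists w, d \in s -> rho (f d) = shift_op w d.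
  case: (boolP (d \in s)) => [/fd/rho_deg[w ew]|_]; first by exists w.
  by exists (fun=> 0).
have {}f0 : \sum_(d <- s) shift_op (w d) d = 0.
  apply: (etrans _ f0); rewrite (raddf_sum rho) [LHS]big_seq [RHS]big_seq.
  by apply: eq_bigr => d /ew rfd; apply: esym.
move=> d ds; rewrite ew //; apply: operatorP => g c /=.
by rewrite (sum_shift_op_eq0 f0) // mul0r.
Qed.

(* A graded ideal [J] meeting [C_0] trivially is killed: if [y] in [J] has degree [d]
   and [c] of degree [-d] acts injectively, then [c * y] lies in [J] and [C_0]. *)
Lemma tgw_rad_ker a : tgw_rad a <-> rho a = 0.
Proof.
split=> [|a0].
  move/(_ [set b | rho b = 0]); apply; first exact: rho_ker_ideal.
  move=> x [J [[Jid Jgr] J0] /Jgr[s [hs ->]]] /=.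
  rewrite (raddf_sum rho) big_seq big1 // => y /hs[Jy [d dy]].
  have [c dc c_inj] := ex_injective_deg (- d).
  have cy0 : c * y = 0.
    have : (J `&` @tgwC_deg k I D 0) (c * y).
      split; first exact: idealMl.
      by rewrite -(addNr d); apply: tgwC_degM.
    by rewrite J0.
  have rcy g : rho c (rho y g) = rho c 0.
    have := congr1 (fun z => rho z g) cy0.
    rewrite (rmorphM rho) (rmorph0 rho) /= => ->.
    by apply/funext => e; rewrite operator0.
  by apply: operatorP => g e; rewrite (c_inj _ _ (rcy g)).
(* Conversely, the kernel is itself one of the ideals being summed: it is graded, and it meets
   degree zero trivially because [rho] is faithful on coefficients. *)
apply: ideal_gen_sub; exists [set a | rho a = 0] => //; split; last first.
  apply/seteqP; split=> [x [/= x0 /tgwC_deg0E[r xr]]|_ ->] /=.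
    by rewrite xr in x0 *; rewrite (rho_inj x0) (rmorph0 (@tgwC_cst k I D)).
  by split; [apply: (rmorph0 rho)|apply: tgwC_deg0].
split=> [|b /= b0]; first exact: rho_ker_ideal.
have [s [f [fd eb]]] := tgwC_decomposition b; exists [seq f d | d <- s].
rewrite big_map; split=> // _ /mapP[d ds ->]; split; last by exists d.
by rewrite eb in b0; apply: (rho_sum_eq0 _ b0).
Qed.

Lemma tgwA_representation : exists2 rhoA : {rmorphism tgwA D -> operator ZI S},
  injective rhoA & forall c, rhoA (rquot_pi (@tgw_rad k I D) c) = rho c.
Proof.
have [|rhoA rhoAE] := @rquot_lift _ _ (@tgw_rad k I D) rho.
  by move=> x /tgw_rad_ker.
exists rhoA => //; apply: raddf_inj => a; have [c ->] := rquot_surj a.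
move=> c0; have c_rad := (tgw_rad_ker c).2 (etrans (esym (rhoAE c)) c0).
rewrite -(rmorph0 (rquot_pi (@tgw_rad k I D))); apply/rquot_piP.
by rewrite subr0; apply: ideal_gen_sub.
Qed.

End ShiftRepresentation.

(** * The representation attached to a multiquiver *)

Section Incidence.
Variables (V E : choiceType) (Q : multiquiver V E).
Local Notation ZV := {malg int[V]}.

(** The [e]-th coordinate of [gamma], obtained by additive extension from the basis of [ZV]. *)
Definition incidence (e : E) : ZV -> int := mmap idfun (mq_coef Q e).

HB.instance Definition _ e := GRing.Additive.on (incidence e).

Lemma incidenceU e v : incidence e << v >> = mq_coef Q e v.
Proof. by rewrite /incidence mmapU mul1r. Qed.

Lemma mcoeff_mq_gamma d e : (mq_gamma Q d)@_e = incidence e d.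
Proof.
rewrite /mq_gamma raddf_sum /incidence mmapE; apply: eq_bigr => v _ /=.
rewrite (raddfMz (mcoeff e)) mulrzz mulrC; congr (_ * _).
(* Local finiteness turns the sum over all edges into a sum over the finitely many edges with
   nonzero coefficient at [v]. *)
rewrite (fsbigTE (fset_set [set e' | mq_coef Q e' v != 0])); last first.
  move=> e'; rewrite in_fset_set ?inE /=; last exact: mq_coef_finite.
  by rewrite notin_setE /= => /negP; rewrite negbK => /eqP ->; rewrite monalgU0.
rewrite raddf_sum /=; under eq_bigr do rewrite mcoeffU.
case: (boolP (e \in fset_set [set e' | mq_coef Q e' v != 0])) => [ev|].
  rewrite (big_fsetD1 e) //= eqxx big1_fset ?addr0 // => e'.
  by rewrite in_fsetD1 => /andP[/negPf ->].
move=> ev; rewrite big_seq big1 => [|e' e'v]; last first.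
  by have [ee'|] := eqVneq e' e; first by rewrite -ee' e'v in ev.
move: ev; rewrite in_fset_set ?inE /=; last exact: mq_coef_finite.
by rewrite notin_setE /= => /negP; rewrite negbK => /eqP ->.
Qed.

Lemma mq_gamma_eq0 d : mq_gamma Q d = 0 <-> forall e, incidence e d = 0.
Proof.
split=> [d0 e|d0]; first by rewrite -mcoeff_mq_gamma d0 mcoeff0.
by apply/malgP => e; rewrite mcoeff_mq_gamma d0 mcoeff0.
Qed.

Lemma mq_gamma_injective :
  injective (mq_gamma Q) <-> forall d, mq_gamma Q d = 0 -> d = 0.
Proof.
have gamma0 : mq_gamma Q 0 = 0.
  by apply/mq_gamma_eq0 => e; apply: (raddf0 (incidence e)).
split=> [inj d|ker0 c d cd]; first by rewrite -gamma0 => /inj.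
apply/eqP; rewrite -subr_eq0; apply/eqP/ker0/mq_gamma_eq0 => e.
by rewrite (raddfB (incidence e)) /= -!mcoeff_mq_gamma cd subrr.
Qed.

(** The sign of a coefficient tells which end of the edge lies at [v]. As an edge has at most one
    target and one source, two distinct vertices cannot have coefficients of the same strict sign on
    it. *)
Lemma mq_coef_gt0 e v n : mq_coef Q e v = Posz n.+1 -> mq_tgt Q e = Some (v, n.+1).
Proof.
rewrite /mq_coef; case: (mq_at (mq_tgt Q e) v) (@mq_atP V (mq_tgt Q e) v).
  by move=> m /(_ m)[h _] [<-]; apply: h.
by move=> _; case: (mq_at (mq_src Q e) v) => [[|m]|].
Qed.

Lemma mq_coef_lt0 e v n : mq_coef Q e v = Negz n -> mq_src Q e = Some (v, n.+1).
Proof.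
rewrite /mq_coef; case: (mq_at (mq_tgt Q e) v) => [m //|].
case: (mq_at (mq_src Q e) v) (@mq_atP V (mq_src Q e) v) => [m /(_ m)[h _]|//].
by case: m h => [|m] h // [<-]; apply: h.
Qed.

End Incidence.

(** * Regularity of the factors [u_e + z] *)

Section PolynomialRegularity.
Variables (k : fieldType) (E : choiceType).
Local Notation polE := (polE k E).
Local Notation u := (@polX k E).

Lemma mcoeff_polXM e (p : polE) m : (u e * p)@_(mmul (ucm e) m) = p@_m.
Proof.
rewrite [LHS](congr1 (mcoeff _) (fgmulUg 1 (ucm e) p)) raddf_sum /=.
rewrite [in RHS](monalgE p) raddf_sum /=; apply: eq_bigr => m' _.
rewrite !mcoeffU mul1r; congr (_ *+ nat_of_bool _).
apply/idP/idP => [/cmP mm'|/eqP -> //]; apply/cmP => i.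
by have := mm' i; rewrite !cmM => /addnI.
Qed.

(* If [(u_e + z) p = 0], the coefficient of [p] at [m u_e] cannot vanish unless the one
   at [m] does, so a nonzero [p] would have unbounded degree in [u_e]. *)
Lemma polX_addz_lreg e (z : int) : GRing.lreg (u e + z%:~R).
Proof.
suff reg (p : polE) : (u e + z%:~R) * p = 0 -> p = 0.
  move=> p q /eqP; rewrite -subr_eq0 -mulrBr => /eqP/reg/eqP.
  by rewrite subr_eq0 => /eqP.
move=> up0.
have step m : p@_m != 0 -> p@_(mmul (ucm e) m) != 0.
  have /eqP := congr1 (mcoeff (mmul (ucm e) m)) up0.
  rewrite mulrDl mulrzl mcoeffD mcoeff_polXM (raddfMz (mcoeff _)) /= mcoeff0.
  rewrite addr_eq0 => /eqP -> ; apply: contra => /eqP ->.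
  by rewrite mul0rz oppr0.
apply/malgP => m; rewrite mcoeff0; apply/eqP; apply: contraT => pm.
have iter_supp n : exists2 m', p@_m' != 0 & (n <= m' e)%N.
  elim: n => [|n [m' pm' le_n]]; first by exists m.
  by exists (mmul (ucm e) m'); [apply: step|rewrite cmM cmUU].
(* One more than the largest exponent of [u_e] in the support of [p]. *)
have [m' pm'] := iter_supp (\max_(m <- msupp p) m e).+1.
have le_m' : (m' e <= \max_(m <- msupp p) m e)%N.
  by rewrite (big_fsetD1 m') -?mcoeff_neq0 //= leq_maxl.
by rewrite ltnNge le_m'.
Qed.

Lemma lreg_prod (S : pzRingType) (I : Type) (r : seq I) (P : pred I) (F : I -> S) :
  (forall i, P i -> GRing.lreg (F i)) -> GRing.lreg (\prod_(i <- r | P i) F i).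
Proof.
move=> Freg; elim/big_ind: _ => //; first exact: lreg1.
by move=> x y; apply: lregM.
Qed.

End PolynomialRegularity.

(** * Rising factorials *)

Section RisingFactorial.
Variable S : comNzRingType.
Implicit Types x : S.

Definition rising x n : S := \prod_(j < n) (x + j%:R).

Lemma rising0 x : rising x 0 = 1.
Proof. exact: big_ord0. Qed.

Lemma risingD x m n : rising x (m + n) = rising x m * rising (x + m%:R) n.
Proof.
rewrite /rising big_split_ord /=; congr (_ * _).
by apply: eq_bigr => j _; rewrite natrD addrA.
Qed.

(** Reversing the order of the factors rewrites the product defining [mq_u] at a negative
    coefficient as a rising factorial. *)
Lemma rising_sub x n : rising (x - n%:R) n = \prod_(j < n) (x - j.+1%:R).
Proof.
rewrite /rising (reindex_inj rev_ord_inj) /=; apply: eq_bigr => j _.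
by rewrite natrB // addrA subrK.
Qed.

Definition pos_part (z : int) := if z is Posz n then n else 0%N.
Definition neg_part (z : int) := if z is Negz n then n.+1 else 0%N.

(* Opposite signs: the shift operators for [v] and [w] use powers of the same letter
   ([x_e] or its derivative) along a common edge, hence commute. *)
Lemma rising_comm x (a b : int) :
  ~~ ((0 < a) && (0 < b)) -> ~~ ((a < 0) && (b < 0)) ->
  rising x (neg_part a) * rising (x - a%:~R) (pos_part b) =
  rising x (pos_part b) * rising (x + b%:~R) (neg_part a).
Proof.
case: a b => [[|n]|n] [m|m] //=; rewrite ?rising0 ?mul1r ?mulr1 ?subr0 //.
  by case: m => [|m] // _ _; rewrite !rising0.
(* In the remaining case [a] is [- n.+1] and [b] is [m]: both sides are the rising factorial of [x]
   of length [n.+1 + m], split at two different places. *)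
move=> _ _; rewrite NegzE mulrNz opprK.
by rewrite -[n.+1%:~R]/(n.+1%:R) -[m%:~R]/(m%:R) -!risingD addnC.
Qed.

End RisingFactorial.

(** * Translations, weights and the faithful representation of [A] *)

Section MultiquiverRepresentation.
Variables (k : fieldType) (V E : choiceType) (Q : multiquiver V E).
Local Notation ZV := {malg int[V]}.
Local Notation polE := (polE k E).
Local Notation u := (@polX k E).
Local Notation coef := (mq_coef Q).
Local Notation inc := (incidence Q).
Local Notation Op := (operator ZV polE).

Definition translate (d : ZV) : polE -> polE :=
  pol_subst (fun e => u e + (inc e d)%:~R).

HB.instance Definition _ d := GRing.LRMorphism.on (translate d).

Lemma translateX d e : translate d (u e) = u e + (inc e d)%:~R.
Proof. exact: pol_substX. Qed.

Lemma translateXz d e (z : int) :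
  translate d (u e + z%:~R) = u e + (inc e d)%:~R + z%:~R.
Proof. by rewrite (rmorphD (translate d)) (rmorph_int (translate d)) /= translateX. Qed.

Lemma translateXB d c e :
  translate d (u e) - translate (d - c) (u e) = (inc e c)%:~R.
Proof.
rewrite !translateX (raddfB (inc e)) /= intrB opprD addrACA subrr add0r.
by rewrite opprB addrC subrK.
Qed.

Lemma translate0 p : translate 0 p = p.
Proof.
apply: (@pol_ext k E (translate 0) idfun) => e /=.
by rewrite translateX (raddf0 (inc e)) addr0.
Qed.

(** This is the relation [X_v r = sigma_v(r) X_v] read on weights: shifting the argument by [v]
    undoes the translation by [sigma_v]. *)
Lemma translate_sig d v p : translate d (mq_sig Q v p) = translate (d - << v >>) p.
Proof.
apply: (@pol_ext k E (translate d \o mq_sig Q v) (translate (d - << v >>))) => e /=.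
rewrite mq_sigX -mulrNz translateXz translateX (raddfB (inc e)) /= incidenceU.
by rewrite -addrA -intrD.
Qed.

Lemma translate_sigV d v p :
  translate d (mq_sigV Q v p) = translate (d + << v >>) p.
Proof.
apply: (@pol_ext k E (translate d \o mq_sigV Q v) (translate (d + << v >>))) => e /=.
rewrite mq_sigVX translateXz translateX (raddfD (inc e)) /= incidenceU.
by rewrite -addrA -intrD.
Qed.

Definition edges (v : V) : {fset E} := fset_set [set e | coef e v != 0].

Lemma edgesP v e : (e \in edges v) = (coef e v != 0).
Proof.
rewrite in_fset_set; last exact: mq_coef_finite.
by apply/idP/idP; rewrite inE.
Qed.

Lemma mq_tE v : mq_t k Q v = \prod_(e <- edges v) mq_u k Q e v.
Proof.
rewrite /mq_t (fsbigTE (edges v)) // => e; rewrite edgesP negbK /mq_u => /eqP ->.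
by rewrite /= big_ord0.
Qed.

(** The factors of [t_v] are shared out by sign: [X_v] takes those of the edges leaving [v], and
    [Y_v] those of the edges entering [v]. *)
Definition weightX v (d : ZV) : polE :=
  \prod_(e <- edges v) rising (translate d (u e)) (neg_part (coef e v)).
Definition weightY v (d : ZV) : polE :=
  \prod_(e <- edges v) rising (translate d (u e)) (pos_part (coef e v)).

(** Allows the weights at two vertices to be compared factor by factor over a common set of
    edges. *)
Lemma weightX_widen v d (s : {fset E}) : (edges v `<=` s)%fset ->
  weightX v d = \prod_(e <- s) rising (translate d (u e)) (neg_part (coef e v)).
Proof.
move=> le; rewrite /weightX (big_fset_incl _ le) // => e _.
by rewrite edgesP negbK => /eqP ->; apply: rising0.
Qed.

Lemma weightY_widen v d (s : {fset E}) : (edges v `<=` s)%fset ->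
  weightY v d = \prod_(e <- s) rising (translate d (u e)) (pos_part (coef e v)).
Proof.
move=> le; rewrite /weightY (big_fset_incl _ le) // => e _.
by rewrite edgesP negbK => /eqP ->; apply: rising0.
Qed.

Lemma translate_addU d v e :
  translate (d + << v >>) (u e) = translate d (u e) + (coef e v)%:~R.
Proof. by rewrite !translateX (raddfD (inc e)) /= incidenceU intrD addrA. Qed.

Lemma translate_subU d v e :
  translate (d - << v >>) (u e) = translate d (u e) - (coef e v)%:~R.
Proof. by rewrite !translateX (raddfB (inc e)) /= incidenceU intrB addrA. Qed.

(** On each edge one of the two rising factorials is empty and the other is the translated factor of
    [t_v]. For a negative coefficient, the shift by [v] supplies the offset in [rising_sub]. *)
Lemma weightYX v d :
  weightY v d * weightX v (d + << v >>) = translate d (mq_t k Q v).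
Proof.
rewrite mq_tE (rmorph_prod (translate d)) -big_split; apply: eq_bigr => e _ /=.
rewrite translate_addU /mq_u; case: (coef e v) => n /=.
  rewrite rising0 mulr1 /rising (rmorph_prod (translate d)); apply: eq_bigr => j _ /=.
  by rewrite (rmorphD (translate d)) (rmorph_nat (translate d)).
rewrite rising0 mul1r (rmorph_prod (translate d)) NegzE mulrNz rising_sub.
apply: eq_bigr => j _ /=.
by rewrite (rmorphB (translate d)) (rmorph_nat (translate d)).
Qed.

(** Edge by edge this is [rising_comm]. Its sign conditions hold because an edge cannot enter, or
    leave, both [v] and [w]. *)
Lemma weight_comm v w d : v != w ->
  weightX v d * weightY w (d - << v >>) = weightY w d * weightX v (d + << w >>).
Proof.
move=> vw; have lev := fsubsetUl (edges v) (edges w).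
have lew := fsubsetUr (edges v) (edges w).
rewrite !(weightX_widen _ lev) !(weightY_widen _ lew) -!big_split /=.
apply: eq_bigr => e _; rewrite translate_addU translate_subU.
apply: rising_comm; apply/negP => /andP[].
  case Ev: (coef e v) => [[|n]|//] //; case Ew: (coef e w) => [[|m]|//] // _ _.
  have := mq_coef_gt0 Ev; rewrite (mq_coef_gt0 Ew) => -[wv _].
  by rewrite wv eqxx in vw.
case Ev: (coef e v) => [//|n]; case Ew: (coef e w) => [//|m] _ _.
have := mq_coef_lt0 Ev; rewrite (mq_coef_lt0 Ew) => -[wv _].
by rewrite wv eqxx in vw.
Qed.

Lemma rising_translate_lreg d e n : GRing.lreg (rising (translate d (u e)) n).
Proof.
apply: lreg_prod => j _; rewrite translateX -addrA -[j%:R]/((Posz j)%:~R) -intrD.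
exact: polX_addz_lreg.
Qed.

Definition cst_op (p : polE) : Op := shift_op (translate^~ p) 0.

Fact cst_op_zmod_morphism : zmod_morphism cst_op.
Proof.
move=> p q; apply: operatorP => g d /=.
by rewrite (rmorphB (translate d)) mulrBl.
Qed.

Fact cst_op_monoid_morphism : monoid_morphism cst_op.
Proof.
split=> [|p q]; apply: operatorP => g d /=.
  by rewrite (rmorph1 (translate d)) mul1r subr0.
by rewrite (rmorphM (translate d)) mulrA !subr0.
Qed.

HB.instance Definition _ :=
  GRing.isZmodMorphism.Build polE Op cst_op cst_op_zmod_morphism.
HB.instance Definition _ :=
  GRing.isMonoidMorphism.Build polE Op cst_op cst_op_monoid_morphism.

Lemma mq_representation : exists rho : {rmorphism mq_alg k Q -> Op},
  [/\ injective rho,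
      forall p, rho (@tgwA_cst k V (mq_datum k Q) p) = shift_op (translate^~ p) 0,
      forall d a, mq_deg k Q d a -> exists w, rho a = shift_op w d
    & forall d, exists2 a, mq_deg k Q d a & a <> 0].
Proof.
pose X v : Op := shift_op (weightX v) << v >>.
pose Y v : Op := shift_op (weightY v) (- << v >>).
have XYC v w : v != w -> X v * Y w = Y w * X v.
  move=> vw; apply: operatorP => g d /=.
  rewrite opprK [LHS]mulrA [RHS]mulrA (addrAC d).
  exact: (congr1 ( *%R^~ _) (weight_comm d vw)).
have cst1 : cst_op 1%:A = 1 by rewrite scale1r (rmorph1 cst_op).
have [|||||rho [rho_cst rho_X rho_Y]] :=
  @tgwC_lift k V (mq_datum k Q) Op cst_op X Y.
- move=> v r; apply: operatorP => g d /=.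
  by rewrite !subr0 translate_sig mulrCA mulrA.
- move=> v r; apply: operatorP => g d /=.
  by rewrite !subr0 opprK translate_sigV mulrCA mulrA.
- move=> v; apply: operatorP => g d /=.
  by rewrite opprK addrK subr0 mulrA weightYX.
- move=> v; apply: operatorP => g d /=.
  (* The relation for [X_v Y_v] is the one for [Y_v X_v] taken at [d - << v >>]. *)
  rewrite opprK subrK subr0 mulrA translate_sig -weightYX subrK.
  by rewrite [weightX _ _ * _]mulrC.
- move=> v w vw; apply: (etrans (XYC v w vw)); congr (_ * _).
  exact: (esym (etrans (congr1 ( *%R^~ (Y w)) cst1) (mul1r _))).
have X_reg v d : GRing.lreg (weightX v d).
  by apply: lreg_prod => e _; apply: rising_translate_lreg.
have Y_reg v d : GRing.lreg (weightY v d).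
  by apply: lreg_prod => e _; apply: rising_translate_lreg.
have H1 r : exists w, rho (tgwC_cst r) = shift_op w 0.
  by rewrite rho_cst; exists (translate^~ r).
have H2 v : exists2 w, forall d, GRing.lreg (w d) &
    rho (tgwC_X (mq_datum k Q) v) = shift_op w << v >>.
  by rewrite rho_X; exists (weightX v).
have H3 v : exists2 w, forall d, GRing.lreg (w d) &
    rho (tgwC_Y (mq_datum k Q) v) = shift_op w (- << v >>).
  by rewrite rho_Y; exists (weightY v).
(* Applied to the constant function [1] and read at degree zero, where the translation is trivial,
   the operator returns [r] itself. *)
have H4 r : rho (tgwC_cst r) = 0 -> r = 0.
  rewrite rho_cst => /(congr1 (fun a : Op => a (fun=> 1) 0)) /=.
  by rewrite translate0 mulr1.
have [rhoA rhoA_inj rhoAE] := tgwA_representation H1 H2 H3 H4.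
exists rhoA; split=> // [p|d _ [c dc <-]|d].
- by rewrite rhoAE rho_cst.
- by rewrite rhoAE; apply: (rho_deg H1 H2 H3 dc).
- have [c dc c_inj] := ex_injective_deg H2 H3 d.
  exists (rquot_pi (@tgw_rad k V (mq_datum k Q)) c); first by exists c.
  move=> /(congr1 rhoA); rewrite rhoAE (rmorph0 rhoA) => c0.
  (* If the class of [c] were zero, its injective operator would send the constant function [1] and
     zero to the same value. *)
  have := c_inj (fun=> 1) 0; rewrite c0 => /(_ erefl).
  by move/(congr1 (fun g => g 0)) => /eqP; rewrite oner_eq0.
Qed.

End MultiquiverRepresentation.

(** * Centralizers *)

Section CommutativeSubrings.
Variable S : pzRingType.
Implicit Types B : set S.

Lemma centralizer_subring B : is_subring (centralizer B).
Proof.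
split=> [r _|x y cx cy r Br|x y cx cy r Br]; first by rewrite mulr1 mul1r.
  by rewrite mulrBl mulrBr cx // cy.
by rewrite -mulrA cy // !mulrA cx.
Qed.

(* For [a] commuting with [B], the subring generated by [B] and [a] is commutative. *)
Lemma maximal_commutative_centralizer B :
  maximal_commutative B -> centralizer B `<=` B.
Proof.
move=> [Bring Bcomm Bmax] a aB.
pose G := B `|` [set a].
pose T : set S := [set x | forall T', is_subring T' -> G `<=` T' -> T' x].
have GT : G `<=` T by move=> x Gx T' _; apply.
have Tring : is_subring T.
  split=> [T' [] //|x y Tx Ty T' T'r GT'|x y Tx Ty T' T'r GT'];
    case: (T'r) => _ T'B T'M; [apply: T'B|apply: T'M];
    by [apply: Tx|apply: Ty].
have GG : G `<=` centralizer G.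
  move=> x [Bx|->] y [By|->] //; [exact: Bcomm|exact/esym/aB|exact: aB].
(* Commutation spreads from [G] to [T] in two steps, since centralizers are subrings: first [T]
   commutes with [G], then [T] commutes with [T]. *)
have TG : T `<=` centralizer G.
  by move=> x; apply => //; apply: centralizer_subring.
have TT : T `<=` centralizer T.
  move=> x; apply; first exact: centralizer_subring.
  by move=> y Gy z /TG zG; apply/esym/zG.
have BT : B `<=` T by move=> x Bx; apply: GT; left.
rewrite -(Bmax T Tring _ BT) => [|x y /TT xT]; last exact: xT.
by apply: GT; right.
Qed.

Lemma centralizer_maximal_commutative B : is_subring B -> commutative_set B ->
  centralizer B `<=` B -> maximal_commutative B.
Proof.
move=> Bring Bcomm CB; split=> // B' _ B'comm BB'.
by apply/seteqP; split=> // x B'x; apply: CB => r /BB' B'r; apply: B'comm.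
Qed.

End CommutativeSubrings.

(** Here characteristic zero enters: a nonzero coordinate of [gamma d] must stay nonzero in [k] to
    force a weight to vanish. *)
Lemma malg_mulrz_eq0 (k : fieldType) (K : choiceType) (p : {malg k[K]}) (z : int) :
  [pchar k] =i pred0 -> z != 0 -> p *~ z = 0 -> p = 0.
Proof.
move=> /pcharf0P k0 z0 pz0; apply/malgP => m; rewrite mcoeff0; apply/eqP.
have := congr1 (mcoeff m) pz0; rewrite (raddfMz (mcoeff m)) mcoeff0 /= => /eqP.
have zk : z%:~R != 0 :> k.
  case: z z0 {pz0} => n; first by rewrite -[n%:~R]/(n%:R) k0.
  by move=> _; rewrite NegzE mulrNz oppr_eq0 -[_%:~R]/(n.+1%:R) k0.
by rewrite -mulrzl mulf_eq0 (negPf zk).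
Qed.

Theorem lemma4p7 (k : fieldType) (hk : [pchar k] =i pred0)
    (V E : choiceType) (Q : multiquiver V E) :
  is_direct_sum (centralizer (mq_R k Q))
    [set d : {malg int[V]} | mq_gamma Q d = 0] (mq_deg k Q) /\
  (injective (mq_gamma Q) <-> maximal_commutative (mq_R k Q)).
Proof.
pose A := mq_alg k Q; pose cst := @tgwA_cst k V (mq_datum k Q).
have [rho [rho_inj rho_cst rho_deg deg_neq0]] := mq_representation k Q.
have rho_eq0 a : rho a = 0 -> a = 0.
  by move=> a0; apply: rho_inj; apply: (etrans a0); apply/esym/(rmorph0 rho).
have rho_sum (s : {fset {malg int[V]}}) (f : {malg int[V]} -> A) :
    (forall d, d \in s -> mq_deg k Q d (f d)) ->
  exists2 w, forall d, d \in s -> rho (f d) = shift_op (w d) d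
    & rho (\sum_(d <- s) f d) = \sum_(d <- s) shift_op (w d) d.
  move=> fd; have /choice[w ew] d : exists w, d \in s -> rho (f d) = shift_op w d.
    case: (boolP (d \in s)) => [/fd/rho_deg[w ew]|_]; first by exists w.
    by exists (fun=> 0).
  exists w => //; rewrite (raddf_sum rho) [LHS]big_seq [RHS]big_seq.
  exact: eq_bigr.
have shift0 w d : (forall c, w c = 0) -> shift_op w d = 0 :> operator _ (polE k E).
  by move=> w0; apply: operatorP => g c; rewrite shift_opE w0 mul0r.
(* For [d] in the kernel of [gamma], the weights of the elements of [R_E] are invariant under the
   shift by [d]. *)
have translate_ker d p c : mq_gamma Q d = 0 ->
    translate Q (c - d) p = translate Q c p :> polE k E.
  move=> /mq_gamma_eq0 d0; congr (pol_subst _ p); apply/funext => e.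
  by rewrite (raddfB (incidence Q e)) /= d0 subr0.
have deg_centralizer d a : mq_gamma Q d = 0 -> mq_deg k Q d a ->
    centralizer (mq_R k Q) a.
  move=> d0 /rho_deg[w ew] _ [p _ <-]; apply: rho_inj.
  apply: (etrans (rmorphM rho _ _)); apply: (etrans _ (esym (rmorphM rho _ _))).
  by rewrite ew rho_cst; apply: shift_op_comm => c; apply: translate_ker.
have Rring : is_subring (mq_R k Q).
  split=> [|_ _ [p _ <-] [q _ <-]|_ _ [p _ <-] [q _ <-]].
  - by exists 1; [|exact: (rmorph1 cst)].
  - by exists (p - q); [|exact: (rmorphB cst)].
  - by exists (p * q); [|exact: (rmorphM cst)].
have Rcomm : commutative_set (mq_R k Q).
  move=> _ _ [p _ <-] [q _ <-].
  apply: (etrans (esym (rmorphM cst p q))); apply: (etrans _ (rmorphM cst q p)).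
  exact: (congr1 cst (@mulrC (polE k E) p q)).
have centralizerP : centralizer (mq_R k Q) = [set x | exists
    (s : {fset {malg int[V]}}) (f : {malg int[V]} -> A),
    (forall d, d \in s -> mq_gamma Q d = 0 /\ mq_deg k Q d (f d)) /\
    x = \sum_(d <- s) f d].
  apply/seteqP; split=> [a aR|_ [s [f [fd ->]]]]; last first.
    move=> r Rr; rewrite mulr_suml mulr_sumr [LHS]big_seq [RHS]big_seq.
    by apply: eq_bigr => d /fd[d0 dfd]; apply: (deg_centralizer d).
  have [s [f [fd def_a]]] := tgwA_decomposition a.
  (* Keep the components of [a] with degree in the kernel; the others are shown to vanish. *)
  exists [fset d in s | mq_gamma Q d == 0]%fset, f; split=> [d|].
    by rewrite !inE => /andP[_ /eqP d0]; split; [|exact: fd].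
  rewrite {1}def_a big_fset /=; apply/esym; rewrite big_mkcond [LHS]big_seq [RHS]big_seq.
  apply: eq_bigr => d ds; case: eqP => // d0; apply/esym/rho_eq0.
  have [w ew ea] := rho_sum s f (fun d _ => fd d).
  (* Commutation with the single variable [u_e], for an edge [e] where [gamma d] is nonzero, is
     enough to kill this component. *)
  have [e de] : exists e, incidence Q e d != 0.
    apply: contrapT => /forallNP de; apply/d0/mq_gamma_eq0 => e.
    by apply/eqP/negPn/negP/de.
  have comm_ue : rho a * rho (cst (polX k e)) = rho (cst (polX k e)) * rho a.
    apply: (etrans (esym (rmorphM rho _ _))); apply: (etrans _ (rmorphM rho _ _)).
    exact: (congr1 rho (aR _ (ex_intro2 _ _ (polX k e) Logic.I erefl))).
  rewrite rho_cst def_a ea in comm_ue.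
  rewrite ew //; apply: shift0 => c; apply: (malg_mulrz_eq0 hk de).
  by have := sum_shift_op_comm comm_ue ds c; rewrite translateXB mulrzl.
split; first split.
- exact: centralizerP.
- move=> s f fd f0 d ds; apply: rho_eq0.
  have [w ew ef] := rho_sum s f (fun d ds => (fd d ds).2).
  rewrite ew //; apply: shift0; apply: sum_shift_op_eq0 (ds).
  by rewrite -ef f0; apply: (rmorph0 rho).
rewrite mq_gamma_injective; split=> [ker0|Rmax d d0].
  apply: centralizer_maximal_commutative => // x; rewrite centralizerP.
  move=> [s [f [fd ->]]].
  (* Only degree zero can occur in [s], and the degree-zero component of [A] is the image of [R_E].
     Outside [s] the value [0] is a default. *)
  have /choice[r er] d : exists r, d \in s -> f d = cst r.
    case: (boolP (d \in s)) => [/fd[/= /ker0 ->]|_]; last by exists 0.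
    by case/tgwA_deg0E => r ->; exists r.
  exists (\sum_(d <- s) r d) => //.
  apply: (etrans (raddf_sum cst _ _ _)); rewrite [LHS]big_seq [RHS]big_seq.
  by apply: eq_bigr => d /er ->.
(* A nonzero [a] of degree [d] in the kernel centralizes [R_E], hence lies in it by maximality. Its
   operator then shifts both by [d] and by zero, which for nonzero [d] would force [a = 0]. *)
have [a da a0] := deg_neq0 d; apply: contra_notP a0 => d_neq0.
have [p _ def_a] := maximal_commutative_centralizer Rmax (deg_centralizer d a d0 da).
have [w ew] := rho_deg d a da; apply: rho_eq0; rewrite ew; apply: shift0.
apply: shift_op_disjoint (etrans (esym ew) (etrans (congr1 rho (esym def_a)) (rho_cst p))).
exact/eqP.
Qed.
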